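(* Let $m\in\mathbb{N}$, let $\mathcal{A}=\mathcal{A}^0\oplus\mathbb{C}\mathbf{1}$ be a unital $*$-algebra ($\mathcal{A}^0$ a $*$-subalgebra), let $a_1,\ldots,a_n\in\mathcal{A}^0$, and let $\phi$ be a state on $\mathcal{A}$ for which $\phi(a_i)=0$, $i=1,\ldots,n$. Let $S_N^{(m)}(a)=\frac{1}{\sqrt N}\sum_{k=1}^N j_k^{(m)}(a)$ for $a\in\mathcal{A}^0$. If $n=2k$ is even, then $$\lim_{N\to\infty}\widetilde{\Phi}\left(S_N^{(m)}(a_1)\cdots S_N^{(m)}(a_n)\right)=\sum_{\{P_1,\ldots,P_k\}\in NC_n^{\rm pair}(m)}\phi(a_{P_1})\cdots\phi(a_{P_k}).$$ If $n$ is odd, then $$\lim_{N\to\infty}\widetilde{\Phi}\left(S_N^{(m)}(a_1)\cdots S_N^{(m)}(a_n)\right)=0.$$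
   Context: $\mathbb{N}=\{1,2,\ldots\}$. A state on a unital complex $*$-algebra is a linear functional $\phi$ with $\phi(\mathbf{1})=1$ and $\phi(x^*x)\ge 0$. Construction of $j_l^{(m)}$ and $\widetilde\Phi$. Let the index set be $I=\mathbb{N}$ and let $\mathcal{A}_l=\mathcal{A}$, $\mathcal{A}_l^0=\mathcal{A}^0$, $\phi_l=\phi$ be copies of the data for each $l\in I$. Let $\widetilde{\mathcal{A}}_l=\mathcal{A}_l*\mathbb{C}(t_l)$ be the free product (units identified) of $\mathcal{A}_l$ with the unital $*$-algebra generated by a single projection $t_l=t_l^*=t_l^2$. Let $\widetilde\phi_l$ be the Boolean extension of $\phi_l$, i.e. the state on $\widetilde{\mathcal{A}}_l$ given by $\widetilde\phi_l(\mathbf{1}_l)=1$, $\widetilde\phi_l(t_l)=1$ and $\widetilde\phi_l(t_l^{r}a^{(1)}t_l a^{(2)}t_l\cdots t_l a^{(p)}t_l^{s})=\phi_l(a^{(1)})\cdots\phi_l(a^{(p)})$ for $a^{(1)},\ldots,a^{(p)}\in\mathcal{A}_l^0$, $r,s\in\{0,1\}$. Let $\mathcal{B}=\bigotimes_{l\in I}\widetilde{\mathcal{A}}_l^{\otimes\infty}$ be the $*$-algebra spanned by simple tensors $\bigotimes_{(l,k)\in I\times\mathbb{N}}x_{l,k}$ with $x_{l,k}\in\widetilde{\mathcal{A}}_l$ and all but finitely many $x_{l,k}\in\{\mathbf{1}_l,t_l\}$ (sitewise product and involution), with the product state $\widetilde\Phi(\bigotimes x_{l,k})=\prod_{l,k}\widetilde\phi_l(x_{l,k})$.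 For $a\in\mathcal{A}_l^0$, $k\in\mathbb{N}$: $\gamma_k^{(l)}(a)\in\mathcal{B}$ is the simple tensor with $a$ at site $(l,k)$, $t_r$ at every site $(r,s)$ with $r\neq l$, $s\ge k$, and units elsewhere; $\widehat\gamma_k^{(l)}(a)$ for $k\geq 2$ is the simple tensor with $a$ at site $(l,k)$, $t_r$ at every site $(r,s)$ with $r\ne l$, $s\ge k-1$, and units elsewhere; $\widehat\gamma_1^{(l)}(a)=0$. Put $j_{l,k}=\gamma_k^{(l)}-\widehat\gamma_k^{(l)}$ and $j_l^{(m)}=\sum_{k=1}^m j_{l,k}:\mathcal{A}_l^0\to\mathcal{B}$ (a $*$-homomorphism). Partitions. A pair partition $P=\{P_1,\ldots,P_k\}$ of $\{1,\ldots,2k\}$, with $P_j=\{\alpha(j),\beta(j)\}$, $\alpha(j)<\beta(j)$, is crossing if there are $p,q$ with $\alpha(p)<\alpha(q)<\beta(p)<\beta(q)$, otherwise non-crossing. The depth $d(P)$ of a non-crossing $P$ is the maximal $d$ for which there exist $s_1,\ldots,s_d$ with $\alpha(s_1)<\cdots<\alpha(s_d)$ and $\beta(s_1)>\cdots>\beta(s_d)$. $NC_n^{\rm pair}(m)$ is the set of non-crossing pair partitions of $\{1,\ldots,n\}$ of depth $\le m$. For $J\subset\{1,\ldots,n\}$, $a_J=\prod_{l\in J}a_l$ with the product taken in the natural (increasing) order. *)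

(* Defs.v *)
From HB Require Import structures.
From mathcomp Require Import all_boot all_order all_algebra.
From mathcomp Require Import all_classical all_reals all_analysis.
From mathcomp Require Import finmap complex ring.
Set Implicit Arguments.
Unset Strict Implicit.
Unset Printing Implicit Defensive.
Import Order.TTheory GRing.Theory Num.Theory.
Import numFieldNormedType.Exports.
Local Open Scope classical_set_scope.
Local Open Scope ring_scope.
Local Open Scope quotient_scope.

HB.mixin Record isStarAlgebra (C : numClosedFieldType) A
    of GRing.Algebra C A := {
  star : A -> A;
  starK : involutive star;
  starD : {morph star : x y / x + y};
  starZ : forall (c : C) (x : A), star (c *: x) = c^* *: star x;
  starM : forall x y : A, star (x * y) = star y * star x
}.

#[short(type="starAlgType")]
HB.structure Definition StarAlgebra (C : numClosedFieldType) :=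
  {A of GRing.Algebra C A & isStarAlgebra C A}.

Definition is_state (C : numClosedFieldType) (A : starAlgType C)
    (phi : {scalar A}) : Prop :=
  phi 1 = 1 /\ forall x : A, 0 <= phi (star x * x).

(* [A0] is a (not necessarily unital) *-subalgebra and A = A0 (+) C.1 *)
Definition star_subalgebra (C : numClosedFieldType) (A : starAlgType C)
    (A0 : set A) : Prop :=
  [/\ A0 0,
      forall (c : C) (x y : A), A0 x -> A0 y -> A0 (c *: x + y),
      forall x y : A, A0 x -> A0 y -> A0 (x * y) &
      forall x : A, A0 x -> A0 (star x)].

Definition unit_complement (C : numClosedFieldType) (A : starAlgType C)
    (A0 : set A) : Prop :=
  (forall x : A, exists a (c : C), A0 a /\ x = a + c *: 1) /\
  (forall c : C, A0 (c *: 1) -> c = 0).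

Inductive star_term (C X : Type) : Type :=
| Gen of X
| Zero
| One
| Add of star_term C X & star_term C X
| Mul of star_term C X & star_term C X
| Scale of C & star_term C X
| Star of star_term C X.
Arguments Zero {C X}.
Arguments One {C X}.
Arguments Gen {C X}.

(* The least congruence on terms that contains [rel] and makes the quotient
   a unital *-algebra over [C]. *)
Inductive star_congr (C : numClosedFieldType) (X : Type)
    (rel : star_term C X -> star_term C X -> Prop) :
    star_term C X -> star_term C X -> Prop :=
| sc_rel u v : rel u v -> star_congr rel u v
| sc_refl u : star_congr rel u u
| sc_sym u v : star_congr rel u v -> star_congr rel v u
| sc_trans u v w :
    star_congr rel u v -> star_congr rel v w -> star_congr rel u w
| sc_add u u' v v' : star_congr rel u u' -> star_congr rel v v' ->
    star_congr rel (Add u v) (Add u' v')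
| sc_mul u u' v v' : star_congr rel u u' -> star_congr rel v v' ->
    star_congr rel (Mul u v) (Mul u' v')
| sc_scale c u u' : star_congr rel u u' ->
    star_congr rel (Scale c u) (Scale c u')
| sc_star u u' : star_congr rel u u' -> star_congr rel (Star u) (Star u')
| sc_addA u v w : star_congr rel (Add u (Add v w)) (Add (Add u v) w)
| sc_addC u v : star_congr rel (Add u v) (Add v u)
| sc_add0 u : star_congr rel (Add Zero u) u
| sc_addN u : star_congr rel (Add (Scale (-1) u) u) Zero
| sc_mulA u v w : star_congr rel (Mul u (Mul v w)) (Mul (Mul u v) w)
| sc_mul1l u : star_congr rel (Mul One u) u
| sc_mul1r u : star_congr rel (Mul u One) u
| sc_mulDl u v w :
    star_congr rel (Mul (Add u v) w) (Add (Mul u w) (Mul v w))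
| sc_mulDr u v w :
    star_congr rel (Mul u (Add v w)) (Add (Mul u v) (Mul u w))
| sc_scaleA c d u : star_congr rel (Scale c (Scale d u)) (Scale (c * d) u)
| sc_scale1 u : star_congr rel (Scale 1 u) u
| sc_scaleDr c u v :
    star_congr rel (Scale c (Add u v)) (Add (Scale c u) (Scale c v))
| sc_scaleDl c d u :
    star_congr rel (Scale (c + d) u) (Add (Scale c u) (Scale d u))
| sc_scaleAl c u v : star_congr rel (Scale c (Mul u v)) (Mul (Scale c u) v)
| sc_scaleAr c u v : star_congr rel (Scale c (Mul u v)) (Mul u (Scale c v))
| sc_starK u : star_congr rel (Star (Star u)) u
| sc_starD u v : star_congr rel (Star (Add u v)) (Add (Star u) (Star v))
| sc_starZ c u : star_congr rel (Star (Scale c u)) (Scale c^* (Star u))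
| sc_starM u v : star_congr rel (Star (Mul u v)) (Mul (Star v) (Star u)).

HB.instance Definition _ (C X : Type) := gen_eqMixin (star_term C X).
HB.instance Definition _ (C X : Type) := gen_choiceMixin (star_term C X).

(* [algType] excludes the zero algebra, hence the second field. *)
Record star_presentation (C : numClosedFieldType) (X : Type) := StarPres {
  sp_rel : star_term C X -> star_term C X -> Prop;
  sp_nontriv : ~ star_congr sp_rel One Zero
}.

Section Presented.
Variables (C : numClosedFieldType) (X : Type) (pres : star_presentation C X).
Local Notation rel := (sp_rel pres).
Implicit Types u v w : star_term C X.

Definition star_congrb u v : bool := `[< star_congr rel u v >].

Lemma star_congrb_refl : reflexive star_congrb.
Proof. by move=> u; apply/asboolP/sc_refl. Qed.

Lemma star_congrb_sym : symmetric star_congrb.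
Proof. by move=> u v; apply/asboolP/asboolP => /sc_sym. Qed.

Lemma star_congrb_trans : transitive star_congrb.
Proof.
by move=> v u w /asboolP uv /asboolP vw; apply/asboolP/(sc_trans uv vw).
Qed.

Canonical star_congr_equiv :=
  EquivRel star_congrb star_congrb_refl star_congrb_sym star_congrb_trans.

Definition presented := {eq_quot star_congr_equiv}.

HB.instance Definition _ := Choice.on presented.
HB.instance Definition _ := Quotient.on presented.

Definition pcls u : presented := \pi_presented u.

Lemma pclsP u v : pcls u = pcls v <-> star_congr rel u v.
Proof.
split=> [/eqP|uv]; first by rewrite /pcls eqmodE => /asboolP.
by apply/eqP; rewrite /pcls eqmodE; apply/asboolP.
Qed.

Lemma pclsW (P : presented -> Prop) : (forall u, P (pcls u)) -> forall x, P x.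
Proof. by move=> PP x; rewrite -[x]reprK; apply: PP. Qed.

Lemma repr_pcls u : star_congr rel (repr (pcls u)) u.
Proof. by apply/pclsP; rewrite {1}/pcls reprK. Qed.

Definition p0 : presented := pcls Zero.
Definition p1 : presented := pcls One.
Definition padd (x y : presented) : presented := pcls (Add (repr x) (repr y)).
Definition pmul (x y : presented) : presented := pcls (Mul (repr x) (repr y)).
Definition pscale (c : C) (x : presented) : presented :=
  pcls (Scale c (repr x)).
Definition popp (x : presented) : presented := pscale (-1) x.
Definition pstar (x : presented) : presented := pcls (Star (repr x)).

Lemma pcls_add u v : padd (pcls u) (pcls v) = pcls (Add u v).
Proof. by apply/pclsP/sc_add; apply: repr_pcls. Qed.

Lemma pcls_mul u v : pmul (pcls u) (pcls v) = pcls (Mul u v).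
Proof. by apply/pclsP/sc_mul; apply: repr_pcls. Qed.

Lemma pcls_scale c u : pscale c (pcls u) = pcls (Scale c u).
Proof. by apply/pclsP/sc_scale; apply: repr_pcls. Qed.

Lemma pcls_star u : pstar (pcls u) = pcls (Star u).
Proof. by apply/pclsP/sc_star; apply: repr_pcls. Qed.

Let pclsE := (pcls_add, pcls_mul, pcls_scale, pcls_star).

Fact paddA : associative padd.
Proof.
elim/pclsW=> u; elim/pclsW=> v; elim/pclsW=> w.
by rewrite !pclsE; apply/pclsP/sc_addA.
Qed.

Fact paddC : commutative padd.
Proof.
by elim/pclsW=> u; elim/pclsW=> v; rewrite !pclsE; apply/pclsP/sc_addC.
Qed.

Fact padd0 : left_id p0 padd.
Proof. by elim/pclsW=> u; rewrite /p0 !pclsE; apply/pclsP/sc_add0. Qed.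

Fact paddN : left_inverse p0 popp padd.
Proof. by elim/pclsW=> u; rewrite /popp !pclsE; apply/pclsP/sc_addN. Qed.

HB.instance Definition _ :=
  GRing.isZmodule.Build presented paddA paddC padd0 paddN.

Fact pmulA : associative pmul.
Proof.
elim/pclsW=> u; elim/pclsW=> v; elim/pclsW=> w.
by rewrite !pclsE; apply/pclsP/sc_mulA.
Qed.

Fact pmul1l : left_id p1 pmul.
Proof. by elim/pclsW=> u; rewrite /p1 !pclsE; apply/pclsP/sc_mul1l. Qed.

Fact pmul1r : right_id p1 pmul.
Proof. by elim/pclsW=> u; rewrite /p1 !pclsE; apply/pclsP/sc_mul1r. Qed.

Fact pmulDl : left_distributive pmul padd.
Proof.
elim/pclsW=> u; elim/pclsW=> v; elim/pclsW=> w.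
by rewrite !pclsE; apply/pclsP/sc_mulDl.
Qed.

Fact pmulDr : right_distributive pmul padd.
Proof.
elim/pclsW=> u; elim/pclsW=> v; elim/pclsW=> w.
by rewrite !pclsE; apply/pclsP/sc_mulDr.
Qed.

HB.instance Definition _ :=
  GRing.Zmodule_isPzRing.Build presented pmulA pmul1l pmul1r pmulDl pmulDr.

Fact pscaleA c d x : pscale c (pscale d x) = pscale (c * d) x.
Proof. by elim/pclsW: x => u; rewrite !pclsE; apply/pclsP/sc_scaleA. Qed.

Fact pscale1 : left_id 1 pscale.
Proof. by elim/pclsW=> u; rewrite !pclsE; apply/pclsP/sc_scale1. Qed.

Fact pscaleDr : right_distributive pscale +%R.
Proof.
move=> c; elim/pclsW=> u; elim/pclsW=> v; rewrite /GRing.add /= !pclsE.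
exact/pclsP/sc_scaleDr.
Qed.

Fact pscaleDl x : {morph pscale^~ x : c d / c + d}.
Proof.
elim/pclsW: x => u c d; rewrite /= [RHS]/GRing.add /= !pclsE.
exact/pclsP/sc_scaleDl.
Qed.

Fact pnz : (1 : presented) != 0.
Proof. by apply/eqP => /pclsP /(sp_nontriv (s := pres)). Qed.

HB.instance Definition _ := GRing.PzSemiRing_isNonZero.Build presented pnz.

HB.instance Definition _ := GRing.Zmodule_isLmodule.Build C presented
  pscaleA pscale1 pscaleDr pscaleDl.

Fact pscaleAl (c : C) (x y : presented) : c *: (x * y) = (c *: x) * y.
Proof.
elim/pclsW: x => u; elim/pclsW: y => v.
rewrite /GRing.scale /GRing.mul /= !pclsE; exact/pclsP/sc_scaleAl.
Qed.

Fact pscaleAr (c : C) (x y : presented) : c *: (x * y) = x * (c *: y).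
Proof.
elim/pclsW: x => u; elim/pclsW: y => v.
rewrite /GRing.scale /GRing.mul /= !pclsE; exact/pclsP/sc_scaleAr.
Qed.

HB.instance Definition _ := GRing.LSemiModule_isLSemiAlgebra.Build C presented
  pscaleAl.
HB.instance Definition _ := GRing.LSemiAlgebra_isSemiAlgebra.Build C presented
  pscaleAr.

Fact pstarK : involutive pstar.
Proof. by elim/pclsW=> u; rewrite !pclsE; apply/pclsP/sc_starK. Qed.

Fact pstarD : {morph pstar : x y / x + y}.
Proof.
elim/pclsW=> u; elim/pclsW=> v; rewrite /GRing.add /= !pclsE.
exact/pclsP/sc_starD.
Qed.

Fact pstarZ (c : C) (x : presented) : pstar (c *: x) = c^* *: pstar x.
Proof.
elim/pclsW: x => u; rewrite /GRing.scale /= !pclsE; exact/pclsP/sc_starZ.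
Qed.

Fact pstarM (x y : presented) : pstar (x * y) = pstar y * pstar x.
Proof.
elim/pclsW: x => u; elim/pclsW: y => v; rewrite /GRing.mul /= !pclsE.
exact/pclsP/sc_starM.
Qed.

HB.instance Definition _ := isStarAlgebra.Build C presented
  pstarK pstarD pstarZ pstarM.

Lemma pcls0E : pcls Zero = 0. Proof. by []. Qed.
Lemma pcls1E : pcls One = 1. Proof. by []. Qed.
Lemma pclsDE u v : pcls (Add u v) = pcls u + pcls v.
Proof. by rewrite -pcls_add. Qed.
Lemma pclsME u v : pcls (Mul u v) = pcls u * pcls v.
Proof. by rewrite -pcls_mul. Qed.
Lemma pclsZE c u : pcls (Scale c u) = c *: pcls u.
Proof. by rewrite -pcls_scale. Qed.
Lemma pclsSE u : pcls (Star u) = star (pcls u).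
Proof. by rewrite -pcls_star. Qed.

End Presented.

Section StarEval.
Variables (C : numClosedFieldType) (X : Type) (D : starAlgType C).
Variable f : X -> D.

Fixpoint star_eval (u : star_term C X) : D :=
  match u with
  | Gen x => f x
  | Zero => 0
  | One => 1
  | Add v w => star_eval v + star_eval w
  | Mul v w => star_eval v * star_eval w
  | Scale c v => c *: star_eval v
  | Star v => star (star_eval v)
  end.

Lemma star0 : star (0 : D) = 0.
Proof. by apply: (addIr (star (0 : D))); rewrite -starD !add0r. Qed.

Lemma star1 : star (1 : D) = 1.
Proof. by rewrite -[LHS]mulr1 -{2}[1](starK (s := D)) -starM mulr1 starK. Qed.

Lemma star_eval_sound rel :
    (forall u v, rel u v -> star_eval u = star_eval v) ->
  forall u v, star_congr rel u v -> star_eval u = star_eval v.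
Proof.
move=> relP u v; elim=> {u v} //=.
- by move=> u v w _ -> _ ->.
- by move=> u u' v v' _ -> _ ->.
- by move=> u u' v v' _ -> _ ->.
- by move=> c u u' _ ->.
- by move=> u u' _ ->.
- by move=> u v w; rewrite addrA.
- by move=> u v; rewrite addrC.
- by move=> u; rewrite add0r.
- by move=> u; rewrite scaleN1r addNr.
- by move=> u v w; rewrite mulrA.
- by move=> u; rewrite mul1r.
- by move=> u; rewrite mulr1.
- by move=> u v w; rewrite mulrDl.
- by move=> u v w; rewrite mulrDr.
- by move=> c d u; rewrite scalerA.
- by move=> u; rewrite scale1r.
- by move=> c u v; rewrite scalerDr.
- by move=> c d u; rewrite scalerDl.
- by move=> c u v; rewrite scalerAl.
- by move=> c u v; rewrite scalerAr.
- by move=> u; rewrite starK.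
- by move=> u v; rewrite starD.
- by move=> c u; rewrite starZ.
- by move=> u v; rewrite starM.
Qed.

End StarEval.

Inductive free_proj_gen (A : Type) : Type := OfAlg of A | Proj.
Arguments Proj {A}.

Definition star_morphism (C : numClosedFieldType) (A D : starAlgType C)
    (f : A -> D) : Prop :=
  [/\ forall (c : C) x y, f (c *: x + y) = c *: f x + f y,
      forall x y, f (x * y) = f x * f y, f 1 = 1 &
      forall x, f (star x) = star (f x)].

Section FreeProj.
Variables (C : numClosedFieldType) (A : starAlgType C).

(* The first four relations make A -> A * C(t) a unital *-homomorphism. *)
Inductive free_proj_rel :
    star_term C (free_proj_gen A) -> star_term C (free_proj_gen A) -> Prop :=
| fp_lin (c : C) (x y : A) :
    free_proj_rel (Gen (OfAlg (c *: x + y)))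
                  (Add (Scale c (Gen (OfAlg x))) (Gen (OfAlg y)))
| fp_mul x y :
    free_proj_rel (Gen (OfAlg (x * y))) (Mul (Gen (OfAlg x)) (Gen (OfAlg y)))
| fp_one : free_proj_rel (Gen (OfAlg 1)) One
| fp_star x : free_proj_rel (Gen (OfAlg (star x))) (Star (Gen (OfAlg x)))
| fp_proj_star : free_proj_rel (Star (Gen Proj)) (Gen Proj)
| fp_proj_idem : free_proj_rel (Mul (Gen Proj) (Gen Proj)) (Gen Proj).

Definition free_proj_gen_map (D : starAlgType C) (f : A -> D) (p : D)
    (g : free_proj_gen A) : D := if g is OfAlg x then f x else p.

Lemma free_proj_eval (D : starAlgType C) (f : A -> D) (p : D) :
    star_morphism f -> star p = p -> p * p = p ->
  forall u v, star_congr free_proj_rel u v ->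
    star_eval (free_proj_gen_map f p) u = star_eval (free_proj_gen_map f p) v.
Proof. by case=> fL fM f1 fS pS pp; apply: star_eval_sound => u v []. Qed.

Fact free_proj_nontriv : ~ star_congr free_proj_rel One Zero.
Proof.
have idM : star_morphism (@id A) by split.
move/(free_proj_eval idM (star1 A) (mulr1 1)) => /= /eqP.
by rewrite oner_eq0.
Qed.

Definition free_proj : starAlgType C := presented (StarPres free_proj_nontriv).

Definition fp_in (x : A) : free_proj :=
  pcls (StarPres free_proj_nontriv) (Gen (OfAlg x)).
Definition fp_t : free_proj := pcls (StarPres free_proj_nontriv) (Gen Proj).

Lemma fp_in_morphism : star_morphism fp_in.
Proof.
split=> [c x y|x y||x]; rewrite /fp_in -?pcls1E -?pclsZE -?pclsDE -?pclsME
  -?pclsSE; apply/pclsP/sc_rel; constructor.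
Qed.

Lemma fp_t_star : star fp_t = fp_t.
Proof. by rewrite -pclsSE; apply/pclsP/sc_rel; constructor. Qed.

Lemma fp_t_idem : fp_t * fp_t = fp_t.
Proof. by rewrite -pclsME; apply/pclsP/sc_rel; constructor. Qed.

Lemma free_proj_universal (D : starAlgType C) (f : A -> D) (p : D) :
    star_morphism f -> star p = p -> p * p = p ->
  exists! F : free_proj -> D,
    [/\ star_morphism F, forall x, F (fp_in x) = f x & F fp_t = p].
Proof.
move=> fM pS pp; have evP := free_proj_eval fM pS pp.
pose F (z : free_proj) := star_eval (free_proj_gen_map f p) (repr z).
have FE u : F (pcls _ u) = star_eval (free_proj_gen_map f p) u.
  exact: (evP _ _ (repr_pcls (StarPres free_proj_nontriv) u)).
exists F; split; first split.
- split=> [c|||]; first by elim/pclsW=> u; elim/pclsW=> v;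
    rewrite -pclsZE -pclsDE !FE.
  + by elim/pclsW=> u; elim/pclsW=> v; rewrite -pclsME !FE.
  + by rewrite -pcls1E FE.
  + by elim/pclsW=> u; rewrite -pclsSE !FE.
- by move=> x; rewrite FE.
- by rewrite FE.
move=> G [[GL GM G1 GS] Gin Gt]; apply/funext; elim/pclsW=> u; rewrite FE.
have G0 : G 0 = 0.
  by have := GL (-1) 0 0; rewrite scaler0 addr0 scaleN1r addNr.
have GD x y : G (x + y) = G x + G y by rewrite -[x]scale1r GL !scale1r.
have GZ c x : G (c *: x) = c *: G x by rewrite -[c *: x]addr0 GL G0 addr0.
elim: u => [[x|]|||u IHu v IHv|u IHu v IHv|c u IHu|u IHu] /=.
- exact/esym/Gin.
- exact/esym/Gt.
- by rewrite pcls0E G0.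
- by rewrite pcls1E G1.
- by rewrite pclsDE GD IHu IHv.
- by rewrite pclsME GM IHu IHv.
- by rewrite pclsZE GZ IHu.
- by rewrite pclsSE GS IHu.
Qed.

End FreeProj.

(* [alt_word x [:: y; ...; z]] is the word x t y t ... t z. *)
Fixpoint alt_word (C : numClosedFieldType) (A : starAlgType C) (x : A)
    (w : seq A) : free_proj A :=
  if w is y :: w' then fp_in x * fp_t A * alt_word y w' else fp_in x.

Definition boolean_extension (C : numClosedFieldType) (A : starAlgType C)
    (A0 : set A) (phi : {scalar A}) (phit : {scalar free_proj A}) : Prop :=
  [/\ is_state phit, phit (fp_t A) = 1 &
      forall (r s : bool) (x : A) (w : seq A),
        A0 x -> (forall y, y \in w -> A0 y) ->
        phit (fp_t A ^+ r * alt_word x w * fp_t A ^+ s) =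
        phi x * \prod_(y <- w) phi y].

(* Simple tensors are indexed by families over the sites (l, k); both l and k
   start from 0, so that site (l, k) stands for (l + 1, k + 1). *)
Record site_family (C : numClosedFieldType) (A : starAlgType C) := SiteFamily {
  site_fun :> nat * nat -> free_proj A;
  site_fin : finite_set [set s | ~ (site_fun s = 1 \/ site_fun s = fp_t A)]
}.

HB.instance Definition _ (C : numClosedFieldType) (A : starAlgType C) :=
  gen_eqMixin (site_family A).

Section Tensor.
Variables (C : numClosedFieldType) (A : starAlgType C).
Local Notation fam := (site_family A).
Implicit Types x y z : fam.

Lemma site_family_eq x y : x =1 y -> x = y.
Proof.
case: x y => [x xP] [y yP] /= /funext xy; rewrite {}xy in xP *.
by congr SiteFamily; apply: Prop_irrelevance.
Qed.

Fact sf_one_fin :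
  finite_set [set s : nat * nat | ~ ((1 : free_proj A) = 1 \/ 1 = fp_t A)].
Proof. by apply: sub_finite_set (@finite_set0 _) => s []; left. Qed.
Definition sf_one : fam := SiteFamily sf_one_fin.

Fact sf_mul_fin x y :
  finite_set [set s | ~ (x s * y s = 1 \/ x s * y s = fp_t A)].
Proof.
apply: (@sub_finite_set _ _ ([set s | ~ (x s = 1 \/ x s = fp_t A)] `|`
  [set s | ~ (y s = 1 \/ y s = fp_t A)])); last first.
  by rewrite finite_setU; split; apply: site_fin.
move=> s /= nxy; apply: contrapT => /not_orP[/contrapT nx /contrapT ny].
apply: nxy; case: nx ny => -> [] ->; rewrite ?mulr1 ?mul1r ?fp_t_idem; auto.
Qed.
Definition sf_mul x y : fam := SiteFamily (sf_mul_fin x y).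

Fact sf_star_fin x :
  finite_set [set s | ~ (star (x s) = 1 \/ star (x s) = fp_t A)].
Proof.
apply: sub_finite_set (site_fin x) => s /= nx [] xE; apply: nx;
  rewrite xE ?star1 ?fp_t_star; auto.
Qed.
Definition sf_star x : fam := SiteFamily (sf_star_fin x).

(* [z = c x + y] in the single coordinate [s], all other coordinates equal *)
Definition site_comb (s : nat * nat) (c : C) x y z : Prop :=
  (forall r, r != s -> x r = z r /\ y r = z r) /\ z s = c *: x s + y s.

Inductive tensor_rel : star_term C fam -> star_term C fam -> Prop :=
| tr_lin s c x y z : site_comb s c x y z ->
    tensor_rel (Gen z) (Add (Scale c (Gen x)) (Gen y))
| tr_mul x y : tensor_rel (Gen (sf_mul x y)) (Mul (Gen x) (Gen y))
| tr_one : tensor_rel (Gen sf_one) One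
| tr_star x : tensor_rel (Gen (sf_star x)) (Star (Gen x)).

(* Modulo [tensor_rel] every term is the linear combination [tnorm u] of simple
   tensors; [tsum F u] extends the function [F] on simple tensors linearly. *)
Fixpoint tnorm (u : star_term C fam) : seq (C * fam) :=
  match u with
  | Gen x => [:: (1, x)]
  | Zero => [::]
  | One => [:: (1, sf_one)]
  | Add v w => tnorm v ++ tnorm w
  | Mul v w => [seq (p.1 * q.1, sf_mul p.2 q.2) | p <- tnorm v, q <- tnorm w]
  | Scale c v => [seq (c * p.1, p.2) | p <- tnorm v]
  | Star v => [seq (p.1^*, sf_star p.2) | p <- tnorm v]
  end.

Definition tsum (F : fam -> C) (u : star_term C fam) : C :=
  \sum_(p <- tnorm u) p.1 * F p.2.

Definition multilinear (F : fam -> C) : Prop :=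
  forall s c x y z, site_comb s c x y z -> F z = c * F x + F y.

Lemma tsum_gen F x : tsum F (Gen x) = F x.
Proof. by rewrite /tsum /= big_seq1 mul1r. Qed.

Lemma tsum_zero F : tsum F Zero = 0.
Proof. by rewrite /tsum big_nil. Qed.

Lemma tsum_one F : tsum F One = F sf_one.
Proof. by rewrite /tsum /= big_seq1 mul1r. Qed.

Lemma tsum_add F u v : tsum F (Add u v) = tsum F u + tsum F v.
Proof. by rewrite /tsum /= big_cat. Qed.

Lemma tsum_mul F u v :
  tsum F (Mul u v) = tsum (fun x => tsum (fun y => F (sf_mul x y)) v) u.
Proof.
rewrite /tsum /= big_allpairs_dep; apply: eq_bigr => p _.
by rewrite mulr_sumr; apply: eq_bigr => q _; rewrite mulrA.
Qed.

Lemma tsum_scale F c u : tsum F (Scale c u) = c * tsum F u.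
Proof.
by rewrite /tsum /= big_map mulr_sumr; apply: eq_bigr => p _; rewrite mulrA.
Qed.

Lemma tsum_star F u :
  tsum F (Star u) = (tsum (fun x => (F (sf_star x))^*) u)^*.
Proof.
rewrite /tsum /= big_map rmorph_sum; apply: eq_bigr => p _.
by rewrite /= rmorphM /= conjCK.
Qed.

Definition tsumE :=
  (tsum_gen, tsum_zero, tsum_one, tsum_add, tsum_mul, tsum_scale, tsum_star).

Lemma eq_tsum F G u : F =1 G -> tsum F u = tsum G u.
Proof. by move=> FG; apply: eq_bigr => p _; rewrite FG. Qed.

Lemma tsum_lin c F G u :
  tsum (fun x => c * F x + G x) u = c * tsum F u + tsum G u.
Proof.
rewrite /tsum mulr_sumr -big_split; apply: eq_bigr => p _ /=.
by rewrite mulrDr mulrCA.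
Qed.

Lemma tsumD F G u : tsum (fun x => F x + G x) u = tsum F u + tsum G u.
Proof.
rewrite -[tsum F u]mul1r -tsum_lin.
by apply: eq_tsum => x; rewrite mul1r.
Qed.

Lemma tsumZ c F u : tsum (fun x => c * F x) u = c * tsum F u.
Proof. by rewrite /tsum mulr_sumr; apply: eq_bigr => p _; rewrite mulrCA. Qed.

Lemma tsum_exchange (F : fam -> fam -> C) u v :
  tsum (fun x => tsum (F x) v) u = tsum (fun y => tsum (F^~ y) u) v.
Proof.
rewrite /tsum; under eq_bigr do rewrite mulr_sumr.
rewrite exchange_big /=; apply: eq_bigr => q _; rewrite mulr_sumr.
by apply: eq_bigr => p _; rewrite mulrCA.
Qed.

Lemma sf_mulA x y z : sf_mul x (sf_mul y z) = sf_mul (sf_mul x y) z.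
Proof. by apply: site_family_eq => s /=; rewrite mulrA. Qed.
Lemma sf_mul1l x : sf_mul sf_one x = x.
Proof. by apply: site_family_eq => s /=; rewrite mul1r. Qed.
Lemma sf_mul1r x : sf_mul x sf_one = x.
Proof. by apply: site_family_eq => s /=; rewrite mulr1. Qed.
Lemma sf_starK x : sf_star (sf_star x) = x.
Proof. by apply: site_family_eq => s /=; rewrite starK. Qed.
Lemma sf_starM x y : sf_star (sf_mul x y) = sf_mul (sf_star y) (sf_star x).
Proof. by apply: site_family_eq => s /=; rewrite starM. Qed.

Lemma site_comb_mulr s c x y z w : site_comb s c x y z ->
  site_comb s c (sf_mul x w) (sf_mul y w) (sf_mul z w).
Proof.
move=> [xyz zE]; split=> [r rs|] /=; first by have [-> ->] := xyz r rs.
by rewrite zE mulrDl scalerAl.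
Qed.

Lemma site_comb_mull s c x y z w : site_comb s c x y z ->
  site_comb s c (sf_mul w x) (sf_mul w y) (sf_mul w z).
Proof.
move=> [xyz zE]; split=> [r rs|] /=; first by have [-> ->] := xyz r rs.
by rewrite zE mulrDr scalerAr.
Qed.

Lemma site_comb_star s c x y z : site_comb s c x y z ->
  site_comb s c^* (sf_star x) (sf_star y) (sf_star z).
Proof.
move=> [xyz zE]; split=> [r rs|] /=; first by have [-> ->] := xyz r rs.
by rewrite zE starD starZ.
Qed.

Lemma tsum_sound u v : star_congr tensor_rel u v ->
  forall F, multilinear F -> tsum F u = tsum F v.
Proof.
elim=> {u v}.
- move=> u v [] => [s c x y z xyz|x y||x] F FL; rewrite !tsumE //.
    exact: FL xyz.
  by rewrite conjCK.
- by [].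
- by move=> u v _ IH F FL; rewrite IH.
- by move=> u v w _ IH1 _ IH2 F FL; rewrite IH1 // IH2.
- by move=> u u' v v' _ IH1 _ IH2 F FL; rewrite !tsumE IH1 // IH2.
- move=> u u' v v' _ IH1 _ IH2 F FL; rewrite !tsumE.
  rewrite (eq_tsum u (G := fun x => tsum (fun y => F (sf_mul x y)) v')).
    apply: IH1 => s c x y z xyz; rewrite -tsum_lin; apply: eq_tsum => w.
    exact: (FL _ _ _ _ _ (site_comb_mulr w xyz)).
  move=> x; apply: IH2 => s c y z w yzw.
  exact: (FL _ _ _ _ _ (site_comb_mull x yzw)).
- by move=> c u u' _ IH F FL; rewrite !tsumE IH.
- move=> u u' _ IH F FL; rewrite !tsumE; congr (_^*).
  apply: IH => s c x y z xyz.
  by rewrite (FL _ _ _ _ _ (site_comb_star xyz)) rmorphD rmorphM /= conjCK.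
- by move=> u v w F FL; rewrite !tsumE addrA.
- by move=> u v F FL; rewrite !tsumE addrC.
- by move=> u F FL; rewrite !tsumE add0r.
- by move=> u F FL; rewrite !tsumE mulN1r addNr.
- move=> u v w F FL; rewrite !tsumE; apply: eq_tsum => x; rewrite tsumE.
  by apply: eq_tsum => y; apply: eq_tsum => z; rewrite sf_mulA.
- by move=> u F FL; rewrite !tsumE; apply: eq_tsum => x; rewrite sf_mul1l.
- move=> u F FL; rewrite !tsumE; apply: eq_tsum => x.
  by rewrite tsumE sf_mul1r.
- by move=> u v w F FL; rewrite !tsumE.
- move=> u v w F FL; rewrite !tsumE -tsumD; apply: eq_tsum => x.
  by rewrite tsumE.
- by move=> c d u F FL; rewrite !tsumE mulrA.
- by move=> u F FL; rewrite !tsumE mul1r.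
- by move=> c u v F FL; rewrite !tsumE mulrDr.
- by move=> c d u F FL; rewrite !tsumE mulrDl.
- by move=> c u v F FL; rewrite !tsumE.
- move=> c u v F FL; rewrite !tsumE -tsumZ; apply: eq_tsum => x.
  by rewrite tsumE.
- move=> u F FL; rewrite !tsumE conjCK; apply: eq_tsum => x.
  by rewrite conjCK sf_starK.
- by move=> u v F FL; rewrite !tsumE rmorphD.
- by move=> c u F FL; rewrite !tsumE rmorphM.
- move=> u v F FL; rewrite !tsumE; congr (_^*); rewrite tsum_exchange.
  apply: eq_tsum => y; rewrite tsumE conjCK; apply: eq_tsum => x.
  by rewrite sf_starM.
Qed.

Definition prod_fun (g : free_proj A -> C) x : C :=
  \big[*%R/1]_(s \in [set: nat * nat]) g (x s).

Lemma site_support (l : seq fam) : exists S : {fset nat * nat},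
  forall x, x \in l -> forall s, s \notin S -> x s = 1 \/ x s = fp_t A.
Proof.
elim: l => [|x l [S SP]]; first by exists fset0.
have /finite_fsetP[T xT] := site_fin x.
exists (S `|` T)%fset => y; rewrite inE => /predU1P[->|/SP yS] s;
  rewrite in_fsetU negb_or.
  move=> /andP[_ sT]; apply: contrapT => xs.
  have : [set` T] s by rewrite -xT.
  by rewrite /= (negbTE sT).
by move=> /andP[/yS].
Qed.

Lemma prod_fun_fset (g : free_proj A -> C) (S : {fset nat * nat}) x :
    g 1 = 1 -> g (fp_t A) = 1 ->
    (forall s, s \notin S -> x s = 1 \/ x s = fp_t A) ->
  prod_fun g x = \prod_(s <- S) g (x s).
Proof. by move=> g1 gt xS; apply: fsbigTE => s /xS[] ->. Qed.

Lemma prod_fun_multilinear (g : {scalar free_proj A}) :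
  g 1 = 1 -> g (fp_t A) = 1 -> multilinear (prod_fun g).
Proof.
move=> g1 gt s c x y z [xyz zE].
have [S SP] := site_support [:: x; y; z].
pose S' := (s |` S)%fset.
have S'P w : w \in [:: x; y; z] ->
    prod_fun g w = g (w s) * \prod_(r <- S' | r != s) g (w r).
  move=> wl; rewrite (@prod_fun_fset g S') //.
    by rewrite (bigD1_seq s) ?fset1U1 ?fset_uniq.
  by move=> r; rewrite in_fset1U negb_or => /andP[_]; apply: SP.
rewrite !S'P ?inE ?eqxx ?orbT //=.
rewrite zE linearP /= mulrDl -mulrA; congr (_ * (_ * _) + _ * _);
  by apply: eq_bigr => r /xyz[xz yz]; rewrite ?xz ?yz.
Qed.

End Tensor.

Lemma exists_scalar (C : fieldType) (V : lmodType C) (f : V -> C) :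
  scalar f -> exists g : {scalar V}, g =1 f.
Proof.
move=> fL; pose g : {scalar V} := HB.pack f (GRing.isLinear.Build C V C _ f fL).
by exists g.
Qed.

Lemma exists_functional (C : fieldType) (V : lmodType C) (e : V) : e != 0 ->
  exists f : {scalar V}, f e = 1.
Proof.
move=> e0.
pose P (W : set V) := ~ W e /\
  forall (c : C) x y, W x -> W y -> W (c *: x + y).
have [|W [[We WL] Wmax]] := @Zorn_bigcup V P.
  move=> F FP Ftot; split=> [[W /FP[We _]]//|c x y [U FU Ux] [W FW Wy]].
  have [UW|WU] := Ftot _ _ FU FW.
    by exists W => //; have [_ WL] := FP _ FW; apply: WL => //; apply: UW.
  by exists U => //; have [_ UL] := FP _ FU; apply: UL => //; apply: WU.
have W0 : W 0.
  apply: contrapT => nW0; apply: (Wmax [set x | x = 0 \/ W x]).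
    split; last by move=> /(_ 0); apply: contra_not nW0; apply; left.
    by move=> x Wx; right.
  split=> [[/eqP|//]|c x y]; first by rewrite (negbTE e0).
  have WZ d z : W z -> W (d *: z).
    by move=> Wz; case: nW0; have := WL (-1) _ _ Wz Wz; rewrite scaleN1r addNr.
  move=> [->|Wx] [->|Wy]; rewrite ?scaler0 ?add0r ?addr0.
  - by left.
  - by right.
  - by right; apply: WZ.
  - by right; apply: WL.
have WZ c x : W x -> W (c *: x) by move=> Wx; rewrite -[_ *: _]addr0; apply: WL.
have WD x y : W x -> W y -> W (x + y).
  by move=> Wx Wy; rewrite -[x]scale1r; apply: WL.
have Wdec x : exists c : C, W (x - c *: e).
  apply: contrapT => /forallNP nx.
  apply: (Wmax [set z | exists c w, W w /\ z = c *: x + w]).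
    split; first by move=> w Ww; exists 0, w; rewrite scale0r add0r.
    move=> /(_ x) xW; apply: (nx 0); rewrite scale0r subr0; apply: xW.
    by exists 1, 0; rewrite scale1r addr0.
  split=> [[c [w [Ww eE]]]|d _ _ [c [w [Ww ->]]] [c' [w' [Ww' ->]]]].
    have [c0|c0] := eqVneq c 0; first by apply: We; rewrite eE c0 scale0r add0r.
    apply: (nx c^-1); rewrite eE scalerDr scalerA mulVf // scale1r.
    by rewrite opprD addNKr -scaleNr; apply: WZ.
  exists (d * c + c'), (d *: w + w'); split; first exact: WL.
  by rewrite scalerDr scalerA scalerDl addrACA.
have Wuniq c d x : W (x - c *: e) -> W (x - d *: e) -> c = d.
  move=> Wc Wd; apply/eqP/contraT => cd; case: We.
  have := WL (-1) _ _ Wc Wd.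
  rewrite scaleN1r opprB addrA subrK -scalerBl => /(WZ (c - d)^-1).
  by rewrite scalerA mulVf ?scale1r // subr_eq0.
pose f x := sval (cid (Wdec x)).
have fP x : W (x - f x *: e) by exact: svalP (cid (Wdec x)).
have fL : scalar f.
  move=> c x y; apply: (Wuniq _ _ (c *: x + y)); first exact: fP.
  rewrite scalerDl -scalerA opprD addrACA -scalerBr.
  exact: WL.
have [g gE] := exists_scalar fL; exists g; rewrite gE.
by apply: (Wuniq _ _ e (fP e)); rewrite scale1r subrr.
Qed.

Section TensorAlgebra.
Variables (C : numClosedFieldType) (A : starAlgType C).

Fact tensor_nontriv : ~ star_congr (@tensor_rel C A) One Zero.
Proof.
have [f f1] := exists_functional (oner_neq0 A).
have idM : star_morphism (@id A) by split.
have [F [[[FL _ F1 _] _ Ft] _]] :=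
  free_proj_universal idM (star1 A) (mulr1 (1 : A)).
have gL : scalar (f \o F) by move=> c x y /=; rewrite FL linearP.
have [g gE] := exists_scalar gL.
have g1 : g 1 = 1 by rewrite gE /= F1.
have gt : g (fp_t A) = 1 by rewrite gE /= Ft.
move=> /tsum_sound /(_ _ (prod_fun_multilinear g1 gt)).
rewrite tsum_one tsum_zero /prod_fun fsbig1 // => /eqP.
by rewrite oner_eq0.
Qed.

Definition tensor_alg : starAlgType C := presented (StarPres tensor_nontriv).

Definition tens (x : site_family A) : tensor_alg :=
  pcls (StarPres tensor_nontriv) (Gen x).

(* All but finitely many factors are phit 1 = 1 or phit t = 1, so the product is
   the finite product over the sites where the factor differs from 1. *)
Definition product_state (phit : {scalar free_proj A})
    (Phit : {scalar tensor_alg}) : Prop :=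
  is_state Phit /\
  forall x : site_family A,
    Phit (tens x) = \big[*%R/1]_(s \in [set: nat * nat]) phit (x s).

End TensorAlgebra.

Section Hierarchy.
Variables (C : numClosedFieldType) (A : starAlgType C).

(* [a] at site (l, k), the projection at the sites (r, s) with r != l and
   s >= h, and 1 elsewhere: h = k gives gamma_k and h = k - 1 its hat. *)
Definition gamma_site (l k h : nat) (a : A) (s : nat * nat) : free_proj A :=
  if s == (l, k) then fp_in a
  else if (s.1 != l) && (h <= s.2)%N then fp_t A else 1.

Fact gamma_site_fin l k h a : finite_set
  [set s | ~ (gamma_site l k h a s = 1 \/ gamma_site l k h a s = fp_t A)].
Proof.
apply: sub_finite_set (finite_set1 (l, k)) => s /=; rewrite /gamma_site.
by case: eqP => // _ []; case: ifP; auto.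
Qed.

Definition gamma (l k : nat) (a : A) : tensor_alg A :=
  tens (SiteFamily (gamma_site_fin l k k a)).

Definition gamma_hat (l k : nat) (a : A) : tensor_alg A :=
  if k is k'.+1 then tens (SiteFamily (gamma_site_fin l k k' a)) else 0.

Definition j_diff (l k : nat) (a : A) : tensor_alg A :=
  gamma l k a - gamma_hat l k a.

(* The paper's indices l, k = 1, 2, ... are shifted to 0, 1, ... *)
Definition j_hier (m l : nat) (a : A) : tensor_alg A :=
  \sum_(k < m) j_diff l k a.

Definition S_hier (m N : nat) (a : A) : tensor_alg A :=
  (sqrtC (N%:R : C))^-1 *: \sum_(l < N) j_hier m l a.

End Hierarchy.

Section PairPartitions.
Variable n : nat.
Implicit Types P : {set {set 'I_n}}.

Definition pair_partition P : bool :=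
  finset.partition P [set: 'I_n]%SET && [forall B in P, #|B| == 2%N].

(* [p] is the pair (alpha(j), beta(j)) of some block P_j *)
Definition is_arc P (p : 'I_n * 'I_n) : bool :=
  (p.1 < p.2)%N && ([set p.1; p.2]%SET \in P).

Definition crossing P : bool :=
  [exists p : 'I_n * 'I_n, exists q : 'I_n * 'I_n,
    [&& is_arc P p, is_arc P q & (p.1 < q.1 < p.2)%N && (p.2 < q.2)%N]].

Definition nested (p q : 'I_n * 'I_n) : bool :=
  (p.1 < q.1)%N && (q.2 < p.2)%N.

(* Chains have at most [n] arcs, so bounding [d] loses nothing. *)
Definition depth P : nat :=
  \max_(d < n.+1 | [exists s : d.-tuple ('I_n * 'I_n),
                      all (is_arc P) s && sorted nested s]) d.

Definition NCpair (m : nat) : {set {set {set 'I_n}}} :=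
  [set P | [&& pair_partition P, ~~ crossing P & (depth P <= m)%N]]%SET.

End PairPartitions.

Section BooleanExtension.
Variables (C : numClosedFieldType) (A : starAlgType C) (phi : {scalar A}).
Hypothesis phi_state : is_state phi.

Lemma state_star x : phi (star x) = (phi x)^*.
Proof.
have [phi1 phi_ge0] := phi_state.
have re y : (phi y + phi (star y))^* = phi y + phi (star y).
  have : phi y + phi (star y) \is Num.real.
    have yE : y + star y = star (1 + y) * (1 + y) - 1 - star y * y.
      rewrite starD star1 mulrDl mul1r mulrDr mulr1 addrA [_ - 1 - _]addrAC.
      by rewrite addrK -[1 + y + _]addrA [1 + (_ + _)]addrC addrK.
    by rewrite -linearD yE !linearB phi1 !rpredB ?real1 ?ger0_real.
  by move/CrealP.
have e1 := re x; have := re ('i *: x); rewrite starZ conjCi !linearZ /=.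
rewrite mulNr -mulrBr rmorphM /= conjCi mulNr -mulrN rmorphB /= opprB.
move/(mulfI (neq0Ci C)) => e2; move: e1; rewrite rmorphD /= => e1.
suff /eqP : (phi (star x) - (phi x)^*) *+ 2 = 0.
  by rewrite mulrn_eq0 subr_eq0 => /eqP.
have -> : (phi (star x) - (phi x)^*) *+ 2 =
    phi x + phi (star x) - ((phi x)^* + (phi (star x))^*) -
    (phi x - phi (star x) - ((phi (star x))^* - (phi x)^*)) by ring.
by rewrite e1 e2 !subrr.
Qed.

(* The *-algebra A * C(t) acts on the vector space A, with A acting by left
   multiplication and t as x |-> phi(x).1; [bool_op u] is the pair of the
   operator of [u] and of its adjoint for the form phi(x^* y). *)
Fixpoint bool_op (u : star_term C (free_proj_gen A)) : (A -> A) * (A -> A) :=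
  match u with
  | Gen (OfAlg a) => (fun x => a * x, fun x => star a * x)
  | Gen Proj => (fun x => phi x *: 1, fun x => phi x *: 1)
  | Zero => (fun=> 0, fun=> 0)
  | One => (id, id)
  | Add v w => (fun x => (bool_op v).1 x + (bool_op w).1 x,
                fun x => (bool_op v).2 x + (bool_op w).2 x)
  | Mul v w => (fun x => (bool_op v).1 ((bool_op w).1 x),
                fun x => (bool_op w).2 ((bool_op v).2 x))
  | Scale c v => (fun x => c *: (bool_op v).1 x,
                  fun x => c^* *: (bool_op v).2 x)
  | Star v => ((bool_op v).2, (bool_op v).1)
  end.

Lemma bool_op_lin u (c : C) x y :
  (bool_op u).1 (c *: x + y) = c *: (bool_op u).1 x + (bool_op u).1 y /\
  (bool_op u).2 (c *: x + y) = c *: (bool_op u).2 x + (bool_op u).2 y.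
Proof.
elim: u c x y => [[a|]|||u IHu v IHv|u IHu v IHv|d u IHu|u IHu] c x y //=.
- by rewrite !mulrDr !scalerAr.
- by rewrite linearP /= scalerDl scalerA.
- by rewrite scaler0 addr0.
- have [-> ->] := IHu c x y; have [-> ->] := IHv c x y.
  by rewrite !scalerDr; split; rewrite addrACA.
- have [-> _] := IHv c x y; have [_ ->] := IHu c x y.
  have [-> _] := IHu c ((bool_op v).1 x) ((bool_op v).1 y).
  by have [_ ->] := IHv c ((bool_op u).2 x) ((bool_op u).2 y).
- have [-> ->] := IHu c x y.
  by rewrite !scalerDr !scalerA mulrC [c * d^*]mulrC.
- by have [-> ->] := IHu c x y.
Qed.

Lemma bool_op_adj u x y :
  phi (star ((bool_op u).1 x) * y) = phi (star x * (bool_op u).2 y) /\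
  phi (star ((bool_op u).2 x) * y) = phi (star x * (bool_op u).1 y).
Proof.
elim: u x y => [[a|]|||u IHu v IHv|u IHu v IHv|d u IHu|u IHu] x y //=.
- by rewrite !starM starK !mulrA.
- rewrite !starZ star1 -scalerAl mul1r -scalerAr mulr1 !linearZ /=.
  by rewrite -state_star mulrC.
- by rewrite star0 mul0r mulr0.
- rewrite !starD !mulrDl !mulrDr !linearD /=.
  by have [-> ->] := IHu x y; have [-> ->] := IHv x y.
- have [-> _] := IHu ((bool_op v).1 x) y.
  have [-> _] := IHv x ((bool_op u).2 y).
  have [_ ->] := IHv ((bool_op u).2 x) y.
  by have [_ ->] := IHu x ((bool_op v).1 y).
- rewrite !starZ conjCK -!scalerAl -!scalerAr !linearZ /=.
  by have [-> ->] := IHu x y.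
- by have [-> ->] := IHu x y.
Qed.

Lemma bool_op_sound u v : star_congr (@free_proj_rel C A) u v ->
  forall x, (bool_op u).1 x = (bool_op v).1 x /\
            (bool_op u).2 x = (bool_op v).2 x.
Proof.
have opD w x y : (bool_op w).1 (x + y) = (bool_op w).1 x + (bool_op w).1 y /\
    (bool_op w).2 (x + y) = (bool_op w).2 x + (bool_op w).2 y.
  by have := bool_op_lin w 1 x y; rewrite !scale1r.
have op0 w : (bool_op w).1 0 = 0 /\ (bool_op w).2 0 = 0.
  have := bool_op_lin w (-1) 0 0.
  by rewrite scaler0 addr0 !scaleN1r !addNr.
have opZ w c x : (bool_op w).1 (c *: x) = c *: (bool_op w).1 x /\
    (bool_op w).2 (c *: x) = c *: (bool_op w).2 x.
  by have := bool_op_lin w c x 0; have [-> ->] := op0 w; rewrite !addr0.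
elim=> {u v} /=.
- move=> u v [c a b|a b||a||] x /=.
  + by rewrite starD starZ !mulrDl !scalerAl.
  + by rewrite starM !mulrA.
  + by rewrite star1 mul1r.
  + by rewrite starK.
  + by [].
  + by rewrite linearZ /= (proj1 phi_state) mulr1.
- by [].
- by move=> u v _ IH x; have [-> ->] := IH x.
- by move=> u v w _ IH1 _ IH2 x; have [-> ->] := IH1 x; exact: IH2.
- by move=> u u' v v' _ IH1 _ IH2 x; have [-> ->] := IH1 x;
    have [-> ->] := IH2 x.
- move=> u u' v v' _ IH1 _ IH2 x; have [-> _] := IH2 x.
  have [_ ->] := IH1 x; have [-> _] := IH1 ((bool_op v').1 x).
  by have [_ ->] := IH2 ((bool_op u').2 x).
- by move=> c u u' _ IH x; have [-> ->] := IH x.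
- by move=> u u' _ IH x; have [-> ->] := IH x.
- by move=> u v w x; rewrite !addrA.
- by move=> u v x; rewrite addrC [X in _ /\ X = _]addrC.
- by move=> u x; rewrite !add0r.
- by move=> u x; rewrite rmorphN1 !scaleN1r !addNr.
- by [].
- by [].
- by [].
- by move=> u v w x; have [_ ->] := opD w ((bool_op u).2 x) ((bool_op v).2 x).
- by move=> u v w x; have [-> _] := opD u ((bool_op v).1 x) ((bool_op w).1 x).
- by move=> c d u x; rewrite !scalerA rmorphM.
- by move=> u x; rewrite rmorph1 !scale1r.
- by move=> c u v x; rewrite !scalerDr.
- by move=> c d u x; rewrite rmorphD !scalerDl.
- by move=> c u v x; have [_ ->] := opZ v c^* ((bool_op u).2 x).
- by move=> c u v x; have [-> _] := opZ u c ((bool_op v).1 x).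
- by [].
- by [].
- by move=> c u x; rewrite conjCK.
- by [].
Qed.

Lemma boolean_extension_exists (A0 : set A) :
  exists phit : {scalar free_proj A}, boolean_extension A0 phi phit.
Proof.
have [phi1 phi_ge0] := phi_state.
pose op (z : free_proj A) x := (bool_op (repr z)).1 x.
have opE u x : op (pcls _ u) x = (bool_op u).1 x.
  by have [] := bool_op_sound (repr_pcls (StarPres (@free_proj_nontriv C A)) u) x.
have opD z w x : op (z + w) x = op z x + op w x.
  by elim/pclsW: z => u; elim/pclsW: w => v; rewrite -pclsDE !opE.
have opM z w x : op (z * w) x = op z (op w x).
  by elim/pclsW: z => u; elim/pclsW: w => v; rewrite -pclsME !opE.
have opZ c z x : op (c *: z) x = c *: op z x.
  by elim/pclsW: z => u; rewrite -pclsZE !opE.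
have op1 x : op 1 x = x by rewrite -pcls1E opE.
have opt x : op (fp_t A) x = phi x *: 1 by rewrite opE.
have opin a x : op (fp_in a) x = a * x by rewrite opE.
have opL z c x : op z (c *: x) = c *: op z x.
  have := bool_op_lin (repr z) c x 0; have := bool_op_lin (repr z) (-1) 0 0.
  rewrite scaler0 addr0 scaleN1r addNr; case=> o0 _.
  by rewrite /op o0 !addr0; case.
have fL : scalar (fun z => phi (op z 1)).
  by move=> c z w; rewrite opD opZ linearP.
have [phit phitE] := exists_scalar fL; exists phit; split.
- split=> [|z]; first by rewrite phitE op1.
  elim/pclsW: z => u; rewrite phitE -pclsSE -pclsME opE /=.
  have [_] := bool_op_adj u ((bool_op u).1 1) 1.
  have [+ _] := bool_op_adj u 1 ((bool_op u).1 1).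
  by rewrite star1 mul1r => <- _; apply: phi_ge0.
- by rewrite phitE opt linearZ /= phi1 mulr1.
move=> r s x w _ _; rewrite phitE opM.
have -> : op (fp_t A ^+ s) 1 = 1.
  by case: s; rewrite ?expr0 ?expr1 ?op1 ?opt ?phi1 ?scale1r.
have opr y : phi (op (fp_t A ^+ r) y) = phi y.
  case: r; rewrite ?expr0 ?expr1 ?op1 // opt linearZ /=.
  by rewrite phi1 mulr1.
rewrite opM opr; elim: w x => [|y w IHw] x.
  by rewrite big_nil !mulr1 opin mulr1.
rewrite big_cons /= !opM opt opin -scalerAr mulr1 linearZ /= IHw.
by rewrite mulrC.
Qed.

End BooleanExtension.

Local Open Scope sesquilinear_scope.

Definition psd_kernel (C : numClosedFieldType) (n : nat)
    (K : 'I_n -> 'I_n -> C) : Prop :=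
  (forall i j, K j i = (K i j)^*) /\
  forall c : 'I_n -> C, 0 <= \sum_i \sum_j (c i)^* * c j * K i j.

(* Schur's product theorem *)
Lemma psd_kernelM (C : numClosedFieldType) (n : nat)
    (K L : 'I_n -> 'I_n -> C) :
  psd_kernel K -> psd_kernel L -> psd_kernel (fun i j => K i j * L i j).
Proof.
move=> [Kh Kp] [Lh Lp]; split=> [i j|c].
  by rewrite rmorphM /= -Kh -Lh.
pose M := \matrix_(i, j) L i j.
have Mh : M \is hermsymmx.
  apply/is_hermitianmxP; rewrite expr0 scale1r; apply/matrixP => i j.
  by rewrite !mxE -Lh.
pose P := spectralmx M; pose d := spectral_diag M.
have PU : P \is unitarymx by exact: spectral_unitarymx.
have ME : M = P^t* *m diag_mx d *m P.
  by have /orthomx_spectralP := hermitian_normalmx Mh; rewrite invmx_unitary.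
have dE : P *m M *m P^t* = diag_mx d.
  rewrite ME !mulmxA (unitarymxP PU) mul1mx -mulmxA (unitarymxP PU).
  by rewrite mulmx1.
have d_ge0 k : 0 <= d 0 k.
  have := Lp (fun i => (P k i)^*).
  suff -> : \sum_i \sum_j (P k i)^*^* * (P k j)^* * L i j = d 0 k by [].
  have /matrixP/(_ k k) := dE; rewrite !mxE eqxx mulr1n => <-.
  under [RHS]eq_bigr do rewrite !mxE mulr_suml.
  rewrite exchange_big /=; apply: eq_bigr => i _; apply: eq_bigr => j _.
  by rewrite !mxE conjCK mulrAC.
have LE i j : L i j = \sum_k (P k i)^* * d 0 k * P k j.
  have /matrixP/(_ i j) := ME; rewrite !mxE => ->; apply: eq_bigr => k _.
  rewrite !mxE; congr (_ * _); rewrite (bigD1 k) //= big1 ?addr0 => [|l lk].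
    by rewrite !mxE eqxx mulr1n.
  by rewrite !mxE (negbTE lk) mulr0n mulr0.
have -> : \sum_i \sum_j (c i)^* * c j * (K i j * L i j) =
    \sum_k d 0 k *
      \sum_i \sum_j (c i * P k i)^* * (c j * P k j) * K i j.
  under [RHS]eq_bigr do rewrite mulr_sumr.
  rewrite [RHS]exchange_big /=; apply: eq_bigr => i _.
  under [RHS]eq_bigr do rewrite mulr_sumr.
  rewrite [RHS]exchange_big /=; apply: eq_bigr => j _.
  rewrite LE !mulr_sumr; apply: eq_bigr => k _; rewrite rmorphM /=.
  by ring.
by apply: sumr_ge0 => k _; apply: mulr_ge0.
Qed.

Lemma product_state_exists (C : numClosedFieldType) (A : starAlgType C)
    (phit : {scalar free_proj A}) : is_state phit -> phit (fp_t A) = 1 ->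
  exists Phit : {scalar tensor_alg A}, product_state phit Phit.
Proof.
move=> phitS phitt; have [phit1 phit_ge0] := phitS.
have gL := prod_fun_multilinear phit1 phitt.
pose f (z : tensor_alg A) := tsum (prod_fun phit) (repr z).
have fE u : f (pcls _ u) = tsum (prod_fun phit) u.
  exact: (tsum_sound (repr_pcls (StarPres (@tensor_nontriv C A)) u) gL).
have fL : scalar f.
  move=> c; elim/pclsW=> u; elim/pclsW=> v.
  by rewrite -pclsZE -pclsDE !fE !tsumE.
have [Phit PhitE] := exists_scalar fL; exists Phit; split; last first.
  by move=> x; rewrite PhitE fE tsumE.
split; first by rewrite PhitE -pcls1E fE tsumE /prod_fun fsbig1.
elim/pclsW=> u; rewrite PhitE -pclsSE -pclsME fE !tsumE.
set l := tnorm u.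
have [S SP] := site_support (map snd l).
pose x0 : C * site_family A := (0, sf_one A).
pose x (i : 'I_(size l)) := (nth x0 l i).2.
pose c (i : 'I_(size l)) := (nth x0 l i).1.
have sumE (F : C * site_family A -> C) :
    \sum_(p <- l) F p = \sum_i F (c i, x i).
  rewrite (big_nth x0) big_mkord; apply: eq_bigr => i _.
  by rewrite /c /x -surjective_pairing.
have xP i s : s \notin S -> x i s = 1 \/ x i s = fp_t A.
  by apply: SP; apply: map_f; apply: mem_nth.
pose K (T : seq (nat * nat)) i j := \prod_(s <- T) phit (star (x i s) * x j s).
have KP T : psd_kernel (K T).
  elim: T => [|s T IHT].
    split=> [i j|d]; first by rewrite /K !big_nil rmorph1.
    under eq_bigr do under eq_bigr do rewrite /K big_nil mulr1.
    under eq_bigr do rewrite -mulr_sumr.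
    rewrite -mulr_suml -rmorph_sum mulrC; exact: mul_conjC_ge0.
  have -> : K (s :: T) = (fun i j => phit (star (x i s) * x j s) * K T i j).
    by apply/funext => i; apply/funext => j; rewrite /K big_cons.
  apply: psd_kernelM => //; split=> [i j|d].
    by rewrite -(state_star phitS) starM starK.
  have := phit_ge0 (\sum_i d i *: x i s); congr (_ <= _).
  have -> : star (\sum_i d i *: x i s) = \sum_i (d i)^* *: star (x i s).
    rewrite (big_morph (@star C (free_proj A)) (@starD _ _) (star0 _)).
    by apply: eq_bigr => i _; rewrite starZ.
  rewrite mulr_suml linear_sum; apply: eq_bigr => i _.
  rewrite mulr_sumr linear_sum; apply: eq_bigr => j _.
  by rewrite -scalerAl -scalerAr !linearZ /= mulrA.
have [_ /(_ c)] := KP S; congr (_ <= _).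
rewrite /tsum sumE rmorph_sum; apply: eq_bigr => i _.
rewrite /= sumE rmorphM /= conjCK mulr_sumr; apply: eq_bigr => j _.
rewrite mulrA; congr (_ * _); apply/esym/prod_fun_fset => // s sS /=.
by have [-> | ->] := xP i s sS; have [-> | ->] := xP j s sS;
  rewrite ?star1 ?fp_t_star ?mul1r ?mulr1 ?fp_t_idem; auto.
Qed.

(* Main.v *)
Require Import Defs.
From mathcomp Require Import all_boot all_order all_algebra.
From mathcomp Require Import all_classical all_reals all_analysis.
From mathcomp Require Import complex zify.
Import Order.TTheory GRing.Theory Num.Theory.
Import numFieldNormedType.Exports.
Set Implicit Arguments.
Unset Strict Implicit.
Unset Printing Implicit Defensive.
Local Open Scope classical_set_scope.
Local Open Scope ring_scope.

(* Expanding the product gives N^(-n/2) times a sum, over the words l of indices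
   in {1..N}, of moments of j_{l_1}(a_1) ... j_{l_n}(a_n). Group the words by
   their kernel partition P; there are N(N-1)...(N-|P|+1) of them.
   - If P has a singleton block {i}, then at the site of a_i the word reads
     t^r a_i t^s, so the moment vanishes by centering.
   - If P is not a pairing and has no singleton, then 2|P| < n, and as the
     moments are bounded the contribution is O(N^(-1/2)).
   - If P is a pairing, expand each j into gamma_k and its hat, with levels k
     and thresholds h = k or h = k - 1. A term is nonzero only if both ends of
     each arc i have the same level and all j strictly inside the arc have
     h_j > k_i; its value is then the product of the phi(a_B). Summing over the
     choices of the thresholds telescopes: what remains is the number of level
     functions k for which k_j is the least level above the levels of all arcs
     covering j. There is at most one; it exists iff P is noncrossing, and it
     then sends an arc to the number of arcs covering it, hence takes values
     below m iff the depth of P is at most m. *)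

(** * Levels of a noncrossing pairing *)

Section Levels.
Variables (n : nat) (pi : 'I_n -> 'I_n).
Hypotheses (piK : involutive pi) (pi_neq : forall i, pi i != i).
Implicit Types (i j : 'I_n) (k : 'I_n -> nat).

Definition covers i j : bool :=
  (minn i (pi i) < j)%N && (j < maxn i (pi i))%N.

(* The conditions left over after summing over the choices between gamma_k and
   its hat: both ends of an arc share a level, and the level is one more than
   the highest level of a covering arc ([\max] over no arc is [0]). *)
Definition levels k : Prop := forall j,
  k j = k (pi j) /\ k j = \max_(i | covers i j) (k i).+1.

Definition noncrossing : Prop :=
  forall i j, ~~ [&& (i < j)%N, (j < pi i)%N & (pi i < pi j)%N].

Lemma partner_ltn i : (i < pi i)%N || (pi i < i)%N.
Proof. by rewrite -neq_ltn eq_sym; exact: pi_neq. Qed.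

Lemma levels_covers k i j : levels k -> covers i j -> (k i < k j)%N.
Proof.
move=> kP ij; rewrite (proj2 (kP j)).
exact: (bigop.leq_bigmax_cond (F := fun i => (k i).+1) i ij).
Qed.

(** An arc covering a left end [j] has its own left end before [j], so the recursion determines [k]
    on left ends by induction on the position; right ends copy their partners. *)
Lemma levels_unique k k' : levels k -> levels k' -> k =1 k'.
Proof.
move=> kP k'P.
suff kE p j : (j < p)%N -> (j < pi j)%N -> k j = k' j.
  move=> j; have /orP[jl|jr] := partner_ltn j; first exact: (kE n).
  rewrite (proj1 (kP j)) (proj1 (k'P j)); apply: (kE n) => //.
  by rewrite piK.
elim: p j => // p IHp j jp jl.
rewrite (proj2 (kP j)) (proj2 (k'P j)); apply: eq_bigr => i /andP[ij _].
congr _.+1; have /orP[il|ir] := partner_ltn i.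
  by apply: IHp => //; lia.
rewrite (proj1 (kP i)) (proj1 (k'P i)).
by apply: IHp => //; rewrite ?piK //; lia.
Qed.

(** In a crossing [i < j < pi i < pi j] the arc of [i] covers [j] and that of [j] covers [pi i],
    forcing [k i < k j < k (pi i) = k i]. *)
Lemma levels_noncrossing k : levels k -> noncrossing.
Proof.
move=> kP i j; apply/negP => /and3P[ij jpi pipj].
have c1 : covers i j by rewrite /covers; lia.
have c2 : covers j (pi i) by rewrite /covers; lia.
have := levels_covers kP c1; have := levels_covers kP c2.
by rewrite -(proj1 (kP i)); lia.
Qed.

Lemma levels_exist : noncrossing -> exists k, levels k.
Proof.
move=> nc.
have piI : injective pi := inv_inj piK.
(* The witness is the number of arcs covering [j], each counted once, by its left end. *)
pose cov j := [set i : 'I_n | (i < pi i)%N && covers i j]%SET.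
pose k j := #|cov j|.
have covP i j : (i \in cov j) = [&& (i < pi i)%N, (i < j)%N & (j < pi i)%N].
  by rewrite inE /covers; have := pi_neq i; lia.
have k_partner j : k j = k (pi j).
  rewrite /k; congr #|pred_of_set _|; apply/setP => i; rewrite !covP.
  case: ltnP => //= il.
  (* Without crossings an arc covers both ends of the arc of [j] or neither. *)
  have h1 := nc i j; have h2 := nc j i; have h3 := nc i (pi j).
  have h4 := nc (pi j) i; have h5 := piK j; rewrite h5 in h3 h4.
  have ne1 := pi_neq j.
  have e1 : (i == j :> nat) -> (pi i == pi j :> nat) by move=> /eqP/val_inj->.
  have e2 : (i == pi j :> nat) -> (pi i == j :> nat).
    by move=> /eqP/val_inj->; rewrite piK.
  have e3 : (pi i == j :> nat) -> (i == pi j :> nat).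
    by move=> /eqP/val_inj <-; rewrite piK.
  have e4 : (pi i == pi j :> nat) -> (i == j :> nat).
    by move=> /eqP/val_inj/piI ->.
  lia.
exists k => j; split; first exact: k_partner.
apply/eqP; rewrite eqn_leq; apply/andP; split; last first.
  (* If the arc of [i] covers [j], all arcs covering [i] cover [j] too, and the arc of [i] itself is
     one more. *)
  apply/bigmax_leqP => i ij; wlog il : i ij / (i < pi i)%N.
    move=> W; have /orP[il|ir] := partner_ltn i; first exact: W.
    rewrite k_partner; apply: W; last by rewrite piK.
    by move: ij; rewrite /covers piK minnC maxnC.
  have ijc : i \in cov j by rewrite inE il.
  rewrite /k (cardsD1 i (cov j)) ijc add1n ltnS subset_leq_card //.
  apply/fintype.subsetP => r; rewrite in_setD1 !covP => /and3P[rl ri ipr].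
  move: ijc; rewrite covP => /and3P[_ ij' jpi]; have := nc r i.
  by apply: contraR; rewrite -val_eqE /= ; lia.
have [cov0|[i0 i0P]] := set_0Vmem (cov j); first by rewrite /k cov0 cards0.
(* The innermost arc covering [j] is covered by all the others. *)
case: (arg_maxnP (fun i : 'I_n => val i) i0P) => i ijc imax.
have {}ijc : i \in cov j := ijc.
have ij : covers i j by move: ijc; rewrite inE => /andP[].
apply: leq_trans (bigop.leq_bigmax_cond (F := fun i => (k i).+1) i ij).
rewrite /k (cardsD1 i (cov j)) ijc add1n ltnS subset_leq_card //.
apply/fintype.subsetP => r; rewrite in_setD1 => /andP[ri rj].
have := imax r rj; move: ijc rj ri; rewrite !covP -val_eqE /=; lia.
Qed.

(** A positive level is one more than that of some covering arc, the one attaining the maximum.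
    Iterating gives [k j + 1] nested arcs ending with that of [j], which bounds the depth from
    below. *)
Lemma levels_chain k : levels k -> forall j, (j < pi j)%N ->
  exists s : seq 'I_n, [/\ size s = k j,
    all (fun i => (i < pi i)%N) (rcons s j) &
    sorted (fun i i' => nested (i, pi i) (i', pi i')) (rcons s j)].
Proof.
move=> kP; have nc := levels_noncrossing kP.
have piI : injective pi := inv_inj piK.
move=> j; have [v] := ubnP (k j); elim: v j => // v IHv j kjv jl.
case: (posnP (k j)) => [-> | kj_gt0]; first by exists [::]; rewrite /= jl.
have [i ij kE] : exists2 i, covers i j & k j = (k i).+1.
  have := proj2 (kP j); have [i0 ij0|cov0] := pickP (covers^~ j).
    have C0 : (0 < #|covers^~ j|)%N by apply/card_gt0P; exists i0.
    by have [i ij ->] := eq_bigmax_cond (fun i => (k i).+1) C0; exists i.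
  by rewrite big_pred0 // => kj0; rewrite kj0 in kj_gt0.
wlog il : i ij kE / (i < pi i)%N.
  move=> W; have /orP[il|ir] := partner_ltn i; first exact: (W i).
  apply: (W (pi i)); rewrite -?(proj1 (kP i)) ?piK //.
  by move: ij; rewrite /covers piK minnC maxnC.
have ki_v : (k i < v)%N by lia.
have [s [sk sl ss]] := IHv i ki_v il; exists (rcons s i).
rewrite size_rcons sk kE all_rcons sl jl; split => //.
have nij : nested (i, pi i) (j, pi j).
  have ne : pi i != pi j.
    by rewrite (inj_eq piI); move: ij; rewrite /covers -val_eqE /=; lia.
  by move: ij ne; have := nc i j; rewrite /covers /nested -val_eqE /=; lia.
move: ss; case: (s) => [_|x s']; rewrite /= ?nij //.
by rewrite !rcons_path last_rcons nij => ->.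
Qed.

End Levels.

(** * Pair partitions as fixed-point-free involutions *)

Section PairPartitions.
Variable n : nat.
Implicit Types (P : {set {set 'I_n}}) (i j : 'I_n).

Lemma pair_partition_partner P : pair_partition P ->
  exists pi : 'I_n -> 'I_n,
    [/\ involutive pi, forall i, pi i != i &
        forall i, finset.pblock P i = [set i; pi i]%SET].
Proof.
case/andP=> partP /forall_inP cardP.
have trivP : finset.trivIset P by case/and3P: partP.
have covP i : i \in finset.cover P.
  by rewrite (finset.cover_partition partP) inE.
have mem_pb i : i \in finset.pblock P i by rewrite finset.mem_pblock.
have [|pi piP] := @boolp.choice _ _
  (fun i j => j != i /\ finset.pblock P i = [set i; j]%SET).
  move=> i; have /cardP/cards2P[x [y [xy pbE]]] := finset.pblock_mem (covP i).
  have := mem_pb i; rewrite pbE !inE => /orP[]/eqP->.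
    by exists y; rewrite eq_sym.
  by exists x; rewrite finset.setUC.
exists pi; split=> [i|i|i]; [|exact: (piP i).1|exact: (piP i).2].
have pbE : finset.pblock P (pi i) = finset.pblock P i.
  apply: finset.same_pblock => //; rewrite (piP i).2 !inE eqxx orbT //.
have := mem_pb i; rewrite -pbE (piP (pi i)).2 !inE eq_sym (negbTE (piP i).1) /=.
by move=> /eqP.
Qed.

Lemma card_pair_partition P : pair_partition P -> n = (#|P| * 2)%N.
Proof.
case/andP=> partP /forall_inP cardP.
rewrite -[LHS]card_ord -cardsT; apply: card_uniform_partition partP.
by move=> B /cardP/eqP.
Qed.

Lemma leq_depth P m : (depth P <= m)%N <->
  forall s, all (is_arc P) s -> sorted (@nested n) s -> (size s <= m)%N.
Proof.
split=> [dm s sP ss|H]; last first.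
  by apply/bigmax_leqP => d /existsP[s /andP[sP ss]]; rewrite -(size_tuple s) H.
have size_s : (size s < n.+1)%N.
  have us : uniq (map fst s).
    apply: (@map_uniq _ _ val); rewrite -map_comp.
    apply: (sorted_uniq ltn_trans ltnn); rewrite sorted_map.
    by apply: sub_sorted ss => p q /andP[].
  rewrite ltnS -(size_map fst) -(card_uniqP us) -[X in (_ <= X)%N]card_ord.
  exact: max_card.
apply: leq_trans dm.
apply: (bigop.leq_bigmax_cond (F := fun d : 'I_n.+1 => val d) (Ordinal size_s)).
by apply/existsP; exists (in_tuple s); rewrite sP.
Qed.

Section Partner.
Variables (P : {set {set 'I_n}}) (pi : 'I_n -> 'I_n).
Hypothesis pairP : pair_partition P.
Hypotheses (piK : involutive pi) (pi_neq : forall i, pi i != i).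
Hypothesis pblockE : forall i, finset.pblock P i = [set i; pi i]%SET.

Lemma is_arc_partner i j : is_arc P (i, j) = (i < j)%N && (j == pi i).
Proof.
have [partP _] := andP pairP; have /and3P[_ trivP _] := partP.
rewrite /is_arc /=; case: ltnP => //= ij; apply/idP/eqP => [ijP|->].
  have := pblockE i; rewrite (finset.def_pblock trivP ijP) ?inE ?eqxx //.
  move/setP/(_ j); rewrite !inE eqxx orbT => /esym/orP[/eqP ji|/eqP//].
  by rewrite ji ltnn in ij.
by rewrite -pblockE finset.pblock_mem // (finset.cover_partition partP) inE.
Qed.

Lemma crossing_partner : ~~ crossing P <-> noncrossing pi.
Proof.
split=> [nc i j|nc]; apply/negP.
  move=> /and3P[ij jpi pipj]; move/negP: nc; apply.
  apply/existsP; exists (i, pi i); apply/existsP; exists (j, pi j).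
  rewrite !is_arc_partner !eqxx /= ij jpi pipj !andbT; lia.
move=> /existsP[[i i'] /existsP[[j j'] /= /and3P[]]].
rewrite !is_arc_partner => /andP[_ /eqP->] /andP[_ /eqP->].
by move=> /andP[/andP[ij jpi] pipj]; have := nc i j; rewrite ij jpi pipj.
Qed.

(** Levels increase strictly along a nested chain, so levels below [m] leave room for at most [m]
    arcs; conversely [levels_chain] turns the level of [i] into a chain with one more arc than this
    level. *)
Lemma levels_NCpair m (k : 'I_n -> nat) : levels pi k ->
  reflect (forall i, (k i < m)%N) (P \in NCpair n m).
Proof.
move=> kP; have nc := levels_noncrossing kP.
rewrite inE pairP (crossing_partner.2 nc) /=; apply: (iffP idP).
  move=> /leq_depth dm i; wlog il : i / (i < pi i)%N.
    move=> W; have /orP[il|ir] := partner_ltn pi_neq i; first exact: W.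
    by rewrite (proj1 (kP i)); apply: W; rewrite piK.
  have [s [sk sl ss]] := levels_chain piK pi_neq kP il.
  rewrite -sk -(size_rcons s i) -(size_map (fun j => (j, pi j))); apply: dm.
    rewrite all_map; apply: sub_all sl => j /= jl.
    by rewrite is_arc_partner jl eqxx.
  by rewrite sorted_map.
move=> km; apply/leq_depth => s sP ss.
have us : uniq (map (fun p : 'I_n * 'I_n => Ordinal (km p.1)) s).
  apply: (@map_uniq _ _ val); rewrite -map_comp.
  apply: (sorted_uniq ltn_trans ltnn); rewrite sorted_map.
  apply: (sub_in_sorted _ sP ss) => -[i i'] [j j'].
  rewrite -!topredE /= !is_arc_partner => /andP[il /eqP ei] /andP[jl /eqP ej].
  subst i' j'.
  move=> /andP[/= ij jli]; apply: (levels_covers kP (i := i) (j := j)).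
  by rewrite /covers; lia.
have := max_card (mem [seq Ordinal (km p.1) | p <- s]).
by rewrite (card_uniqP us) size_map card_ord.
Qed.

(** Level functions are unique, exist for noncrossing pairings, and stay below [m] exactly when the
    depth is at most [m]; so the count is a boolean read as [0] or [1]. *)
Lemma card_levels m :
  #|[pred k : {ffun 'I_n -> 'I_m} | `[< levels pi (fun i => k i) >]]| =
  (P \in NCpair n m).
Proof.
case: (boolP (P \in NCpair n m)) => [PNC|PnNC].
  have [k kP] : exists k, levels pi k.
    apply: levels_exist => //; apply/crossing_partner.
    by move: PNC; rewrite inE => /and3P[].
  have km := elimT (levels_NCpair m kP) PNC.
  pose kf : {ffun 'I_n -> 'I_m} := [ffun i => Ordinal (km i)].
  apply: (@fintype.eq_card1 _ kf) => k'.
  rewrite !inE; apply/asboolP/eqP => [k'P|->].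
    apply/ffunP => i; apply: val_inj.
    by rewrite ffunE /= (levels_unique piK pi_neq k'P kP).
  by congr (levels pi _): kP; apply/funext => i; rewrite ffunE.
apply: fintype.eq_card0 => k; rewrite !inE; apply/asboolP => kP.
by move/negP: PnNC; apply; apply/(levels_NCpair m kP) => i.
Qed.

End Partner.
End PairPartitions.
(** * Moments of words of simple tensors *)

(** The ring need not be commutative, so the order of the factors matters: the enumeration of ['I_n]
    is increasing and hence splits at [j]. *)
Lemma prod_ord_split (R : pzSemiRingType) (n : nat) (P : pred 'I_n)
    (F : 'I_n -> R) (j : 'I_n) : P j ->
  \prod_(i | P i) F i =
  (\prod_(i | P i && (i < j)%N) F i) * F j * \prod_(i | P i && (j < i)%N) F i.
Proof.
move=> Pj; have : j \in index_enum 'I_n by exact: mem_index_enum.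
have : pairwise (fun i1 i2 : 'I_n => (i1 < i2)%N) (index_enum 'I_n).
  have := iota_ltn_sorted 0 n; rewrite (sorted_pairwise ltn_trans).
  by rewrite -val_enum_ord pairwise_map enumT.
move: (index_enum _) => s ss /splitPr sE.
move: ss; case: sE => s1 s2.
rewrite pairwise_cat pairwise_cons allrel_consr.
move=> /and3P[/andP[l1 _] _ /andP[l2 _]].
have filterP (b : bool) (Q : pred 'I_n) r : all (fun i => Q i == b) r ->
    \prod_(i <- r | P i && Q i) F i = if b then \prod_(i <- r | P i) F i else 1.
  elim: r => [|i r IHr] /=; first by rewrite !big_nil; case: b.
  move=> /andP[/eqP Qi /IHr {}IHr]; rewrite !big_cons Qi IHr.
  by case: (b); rewrite ?andbT ?andbF.
rewrite !big_cat !big_cons /= Pj ltnn /=.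
have ltj b := filterP b (fun i : 'I_n => (i < j)%N).
have gtj b := filterP b (fun i : 'I_n => (j < i)%N).
rewrite (ltj true s1) ?(ltj false s2) ?(gtj false s1) ?(gtj true s2);
  rewrite ?mulr1 ?mul1r ?mulrA //.
all: by [apply: sub_all l1 => i /= ij; rewrite ?ij // ltnNge ltnW
        |apply: sub_all l2 => i /= ij; rewrite ?ij // ltnNge ltnW].
Qed.

Section Words.
Variables (C : numClosedFieldType) (A : starAlgType C) (A0 : set A).
Variables (phi : {scalar A}) (phit : {scalar free_proj A}).
Hypothesis (A0_sub : star_subalgebra A0).
Hypothesis (phit_bool : boolean_extension A0 phi phit).

Definition proj_power (y : free_proj A) : Prop := y = 1 \/ y = fp_t A.

Lemma proj_power_expr y : proj_power y -> exists r : bool, y = fp_t A ^+ r.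
Proof. by case=> ->; [exists false | exists true]. Qed.

Lemma proj_power_prod (I : Type) (s : seq I) (P : pred I)
    (F : I -> free_proj A) :
  (forall i, P i -> proj_power (F i)) -> proj_power (\prod_(i <- s | P i) F i).
Proof.
move=> FP; elim/big_ind: _ => //; first by left.
by move=> x y [] -> [] ->; rewrite ?mul1r ?mulr1 ?fp_t_idem; [left|right..].
Qed.

Lemma phit_proj_power y : proj_power y -> phit y = 1.
Proof. by have [[phit1 _] phitt _] := phit_bool; case=> ->. Qed.

Lemma phit_one_letter y z x : proj_power y -> proj_power z -> A0 x ->
  phit (y * fp_in x * z) = phi x.
Proof.
move=> /proj_power_expr[r ->] /proj_power_expr[s ->] A0x.
have [_ _ /(_ r s x [::] A0x)] := phit_bool.
by rewrite big_nil mulr1; apply.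
Qed.

Lemma phit_adjacent_letters y z x1 x2 : proj_power y -> proj_power z ->
  A0 x1 -> A0 x2 -> phit (y * fp_in x1 * fp_in x2 * z) = phi (x1 * x2).
Proof.
move=> yP zP A1 A2; have [_ fpM _ _] := fp_in_morphism A.
have [_ _ A0M _] := A0_sub.
by rewrite -(mulrA y) -fpM phit_one_letter //; apply: A0M.
Qed.

Lemma phit_separated_letters y z x1 x2 : proj_power y -> proj_power z ->
  A0 x1 -> A0 x2 ->
  phit (y * fp_in x1 * fp_t A * fp_in x2 * z) = phi x1 * phi x2.
Proof.
move=> /proj_power_expr[r ->] /proj_power_expr[s ->] A1 A2.
have [_ _ /(_ r s x1 [:: x2] A1)] := phit_bool.
by rewrite big_seq1 /= !mulrA; apply=> w; rewrite inE => /eqP->.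
Qed.

(** One factor [t] absorbs all the others, by idempotence. *)
Lemma proj_power_prod_t (I : finType) (P : pred I) (F : I -> free_proj A) i :
  (forall j, P j -> proj_power (F j)) -> P i -> F i = fp_t A ->
  \prod_(j | P j) F j = fp_t A.
Proof.
move=> FP; have : i \in index_enum I by exact: mem_index_enum.
elim: (index_enum I) => // j s IHs; rewrite inE big_cons.
move=> /predU1P[<- Pi Fi|/IHs{}IHs Pi Fi].
  rewrite Pi Fi; have [->|->] := proj_power_prod s FP; last exact: fp_t_idem.
  by rewrite mulr1.
rewrite (IHs Pi Fi); case: ifP => // /FP[]->; [exact: mul1r|exact: fp_t_idem].
Qed.

Variables (n : nat) (a : 'I_n -> A).
Hypotheses (a_A0 : forall i, A0 (a i)) (a_centered : forall i, phi (a i) = 0).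
Implicit Types (i j : 'I_n) (l k h : 'I_n -> nat) (s : nat * nat).

(* [h i = k i] selects gamma and [h i = k i - 1] its hat at the position [i]. *)
Definition word l k h : site_family A :=
  \big[@sf_mul C A/sf_one A]_i
    SiteFamily (gamma_site_fin (l i) (k i) (h i) (a i)).

Lemma wordE l k h s :
  word l k h s = \prod_i gamma_site (l i) (k i) (h i) (a i) s.
Proof.
exact: (big_morph (fun x : site_family A => x s) (fun _ _ => erefl) erefl).
Qed.

Lemma tens_word l k h : tens (word l k h) =
  \prod_i tens (SiteFamily (gamma_site_fin (l i) (k i) (h i) (a i))).
Proof.
apply: (big_morph (@tens C A)) => [x y|].
  by rewrite /tens -pclsME; apply/pclsP/sc_rel; constructor.
by rewrite /tens -pcls1E; apply/pclsP/sc_rel; constructor.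
Qed.

Lemma gamma_site_proj (l0 k0 h0 : nat) b s :
  s != (l0, k0) -> proj_power (gamma_site l0 k0 h0 b s).
Proof.
by rewrite /gamma_site => /negbTE->; case: ifP; [right|left].
Qed.

Lemma word_proj l k h s :
  (forall i, s != (l i, k i)) -> proj_power (word l k h s).
Proof.
move=> sP; rewrite wordE.
by apply: proj_power_prod => i _; apply: gamma_site_proj.
Qed.

Lemma phit_word_single l k h i :
  (forall j, j != i -> (l j, k j) != (l i, k i)) ->
  phit (word l k h (l i, k i)) = 0.
Proof.
move=> si; rewrite wordE (prod_ord_split _ (j := i)) //= {2}/gamma_site eqxx.
rewrite phit_one_letter ?a_centered //; apply: proj_power_prod => j ji;
  apply: gamma_site_proj; rewrite eq_sym si //; apply/eqP => e;
  by rewrite e ltnn in ji.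
Qed.

Section PhitValue.
Variables (Phit : {scalar tensor_alg A}) (Phit_prod : product_state phit Phit).

(** Sites outside [r] carry no letter, only [1] or [t], and [phit] is [1] on both. *)
Lemma Phit_word (r : seq (nat * nat)) l k h :
  uniq r -> (forall i, (l i, k i) \in r) ->
  Phit (tens (word l k h)) = \prod_(s <- r) phit (word l k h s).
Proof.
move=> r_uniq rP; have [_ ->] := Phit_prod.
rewrite (fsbigE r) => // [|s _ sr]; last first.
  apply/phit_proj_power/word_proj => i; apply: contraNneq sr => ->; exact: rP.
by apply: eq_bigl => s; rewrite in_setT.
Qed.

Lemma Phit_word_single l k h i :
  (forall j, j != i -> (l j, k j) != (l i, k i)) ->
  Phit (tens (word l k h)) = 0.
Proof.
move=> si; pose r := undup [seq (l j, k j) | j <- enum 'I_n].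
have rP j : (l j, k j) \in r by rewrite mem_undup map_f // mem_enum.
rewrite (Phit_word (r := r) h (undup_uniq _) rP).
rewrite (bigD1_seq (l i, k i)) ?undup_uniq //=.
by rewrite phit_word_single ?mul0r.
Qed.

Lemma Phit_word_bounded :
  exists K : C, forall l k h, `|Phit (tens (word l k h))| <= K.
Proof.
pose y (f : {ffun 'I_n -> option bool}) : free_proj A :=
  \prod_i (if f i is Some b then fp_t A ^+ b else fp_in (a i)).
(* The summand [1] gives [1 <= K0], so that the bound with exponent [size r] can be raised to
   exponent [n]. *)
pose K0 := 1 + \sum_f `|phit (y f)|.
have K0_ge1 : 1 <= K0 by rewrite lerDl sumr_ge0.
(* At each site only [3 ^ n] words can occur. *)
exists (K0 ^+ n) => l k h; pose r := undup [seq (l j, k j) | j <- enum 'I_n].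
have rP j : (l j, k j) \in r by rewrite mem_undup map_f // mem_enum.
rewrite (Phit_word (r := r) h (undup_uniq _) rP) normr_prod.
have r_size : (size r <= n)%N.
  by rewrite (leq_trans (size_undup _)) // size_map -cardE card_ord.
apply: (@le_trans _ _ (K0 ^+ size r)); last exact: ler_weXn2l.
suff sK s : `|phit (word l k h s)| <= K0.
  elim: (r) => [|s r' IHr]; first by rewrite big_nil expr0.
  by rewrite big_cons exprS ler_pM // prodr_ge0.
pose f : {ffun 'I_n -> option bool} := [ffun i => if s == (l i, k i) then None
  else Some ((s.1 != l i) && (h i <= s.2)%N)].
have -> : word l k h s = y f.
  rewrite wordE; apply: eq_bigr => i _; rewrite ffunE /gamma_site.
  by case: eqP => //; case: ifP.
by rewrite /K0 (bigD1 f) //= addrCA lerDl addr_ge0 // sumr_ge0.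
Qed.

Section Pair.
Variables (pi : 'I_n -> 'I_n) (l : 'I_n -> nat).
Hypotheses (piK : involutive pi) (pi_neq : forall i, pi i != i).
Hypothesis lE : forall i j, (l i == l j) = (j == i) || (j == pi i).

Let l_partner i : l (pi i) = l i.
Proof. by apply/esym/eqP; rewrite lE eqxx orbT. Qed.

(** At this site the letters are [a i] and [a (pi i)]; any other position [j] contributes [t] if
    [h j <= k i] and [1] otherwise. A [t] between the letters splits the value into
    [phi (a i) * phi (a (pi i)) = 0]; with none they merge into one letter of [A0]. *)
Lemma phit_word_pair k h i : (i < pi i)%N -> k i = k (pi i) ->
  phit (word l k h (l i, k i)) =
  phi (a i * a (pi i)) *
  [forall j : 'I_n, (i < j < pi i)%N ==> (k i < h j)%N]%:R.
Proof.
move=> ipi kpi; rewrite wordE.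
pose G j := gamma_site (l j) (k j) (h j) (a j) (l i, k i).
rewrite -[LHS]/(phit (\prod_j G j)).
have Gi : G i = fp_in (a i) by rewrite /G /gamma_site eqxx.
have Gpi : G (pi i) = fp_in (a (pi i)).
  by rewrite /G /gamma_site l_partner kpi eqxx.
have ne j : j != i -> j != pi i -> l i != l j.
  by move=> ji jpi; rewrite lE negb_or ji.
have G_proj j : j != i -> j != pi i -> proj_power (G j).
  move=> ji jpi; apply: gamma_site_proj; rewrite xpair_eqE negb_and.
  by rewrite ne.
rewrite (prod_ord_split _ (j := i)) //.
rewrite [X in _ * _ * X](prod_ord_split _ (j := pi i)) //=.
rewrite Gi Gpi !mulrA.
set y := \prod_(j < n | (j < i)%N) _.
set z := \prod_(j < n | _ && (pi i < j)%N) _.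
have yP : proj_power y.
  by apply: proj_power_prod => j ji; apply: G_proj; rewrite -val_eqE /=; lia.
have zP : proj_power z.
  by apply: proj_power_prod => j ji; apply: G_proj; rewrite -val_eqE /=; lia.
have mid_proj j : (i < j)%N && (j < pi i)%N -> proj_power (G j).
  by move=> ji; apply: G_proj; rewrite -val_eqE /=; lia.
case: (boolP [forall j, _]) => [/forallP midP|].
  rewrite [X in _ * X * _ * _]big1 => [|j ij]; last first.
    rewrite /G /gamma_site; have := midP j; rewrite ij /= ltnNge => /negbTE ->.
    by rewrite andbF ifN // xpair_eqE negb_and ne // -val_eqE /=; lia.
  by rewrite !mulr1 phit_adjacent_letters.
move=> /forallPn[j]; rewrite negb_imply -leqNgt => /andP[ij hj].
rewrite [X in _ * X * _ * _](proj_power_prod_t mid_proj ij); last first.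
  rewrite /G /gamma_site hj andbT.
  have lij : l i != l j by rewrite ne // -val_eqE /=; lia.
  by rewrite lij xpair_eqE (negbTE lij).
by rewrite phit_separated_letters // a_centered mul0r mulr0.
Qed.

Lemma Phit_word_pair k h : Phit (tens (word l k h)) =
  (\prod_(i : 'I_n | (i < pi i)%N) phi (a i * a (pi i))) *
  `[< (forall i, k i = k (pi i)) /\
      (forall i j, covers pi i j -> (k i < h j)%N) >]%:R.
Proof.
have [kP|] := boolP [forall i, k i == k (pi i)]; last first.
  (* A letter whose partner sits at another level is alone at its site. *)
  move=> /forallPn[i ki]; rewrite (@Phit_word_single l k h i); last first.
    move=> j ji; rewrite xpair_eqE negb_and [l j == _]eq_sym lE (negbTE ji) /=.
    by have [->|] := eqVneq j (pi i); rewrite //= eq_sym.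
  by rewrite asboolF ?mulr0 // => -[/(_ i)/eqP ki' _]; rewrite ki' in ki.
have {}kP i : k i = k (pi i) by apply/eqP/(forallP kP).
(* Each arc occupies one site, listed through its left end. *)
pose L := [seq i : 'I_n <- enum 'I_n | (i < pi i)%N].
have memL (i : 'I_n) : (i \in L) = (i < pi i)%N.
  by rewrite mem_filter mem_enum andbT.
pose r := [seq (l i, k i) | i <- L].
have r_uniq : uniq r.
  rewrite map_inj_in_uniq; first by rewrite filter_uniq ?enum_uniq.
  move=> i j.
  rewrite !memL => il jl [/eqP]; rewrite lE => /orP[/eqP//|/eqP jE].
  by rewrite jE piK in jl; lia.
have rP (i : 'I_n) : (l i, k i) \in r.
  have /orP[il|ir] := partner_ltn pi_neq i; first by rewrite map_f // memL.
  by rewrite -l_partner kP map_f // memL piK.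
rewrite (Phit_word h r_uniq rP) big_map big_filter big_enum_cond /=.
under eq_bigr => i il do rewrite phit_word_pair //.
rewrite big_split /=; congr (_ * _).
case: asboolP => [[_ HP]|nP].
  apply: big1 => i il; rewrite (_ : [forall j, _] = true) //.
  by apply/forallP => j; apply/implyP => ij; apply: HP; rewrite /covers; lia.
have [i [j [ij hj]]] : exists i j, covers pi i j /\ (h j <= k i)%N.
  apply: contrapT => nex; apply: nP; split=> // i j ij; rewrite ltnNge.
  by apply/negP => hj; apply: nex; exists i, j.
wlog il : i ij hj / (i < pi i)%N.
  move=> W; have /orP[il|ir] := partner_ltn pi_neq i; first exact: (W i).
  apply: (W (pi i)); rewrite ?piK -?kP //.
  by move: ij; rewrite /covers piK minnC maxnC.
rewrite (bigD1 i) //= (_ : [forall j, _] = false) ?mul0r //.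
by apply/forallP => /(_ j)/implyP; move: ij; rewrite /covers; lia.
Qed.

End Pair.
End PhitValue.
End Words.

(** * Expansion of the moments over levels and hats *)

Lemma prodr_bool (R : comPzSemiRingType) (I : finType) (b : pred I) :
  \prod_i (b i)%:R = [forall i, b i]%:R :> R.
Proof.
case: (boolP [forall i, b i]) => [/forallP bP|].
  by rewrite big1 // => i _; rewrite bP.
rewrite negb_forall => /existsP[i bi].
by rewrite (bigD1 i) //= (negbTE bi) mul0r.
Qed.

Section Expansion.
Variables (C : numClosedFieldType) (A : starAlgType C).

(* The factor [e <= k] accounts for the convention that the hat vanishes at the
   first level. *)
Lemma j_diffE (l k : nat) (x : A) : j_diff l k x =
  \sum_(e : bool) ((-1) ^+ e * (e <= k)%N%:R) *:
    tens (SiteFamily (gamma_site_fin l k (k - e) x)).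
Proof.
rewrite big_bool /= expr0 expr1 !mul1r subn0 scale1r addrC.
congr (_ + _); case: k => [|k] /=; first by rewrite mulr0 scale0r oppr0.
by rewrite mulr1 scaleN1r subSS subn0.
Qed.

Lemma prod_scale n (c : 'I_n -> C) (x : 'I_n -> tensor_alg A) :
  \prod_i (c i *: x i) = (\prod_i c i) *: \prod_i x i.
Proof.
elim/big_rec3: _ => [|i c' x' xc _ ->]; first by rewrite scale1r.
by rewrite -scalerAl -scalerAr scalerA.
Qed.

Variables (phi : {scalar A}) (Phit : {scalar tensor_alg A}).
Variables (m n : nat) (a : 'I_n -> A).

(** [e i] selects the hat at position [i]. At level [0] with [e i] true, [k i - e i] truncates to
    [0], but the coefficient vanishes. *)
Definition j_moment (l : 'I_n -> nat) : C :=
  \sum_(k : {ffun 'I_n -> 'I_m}) \sum_(e : {ffun 'I_n -> bool})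
    (\prod_i ((-1) ^+ e i * (e i <= k i)%N%:R)) *
    Phit (tens (word a l (fun i => k i) (fun i => (k i - e i)%N))).

Lemma Phit_prod_j_hier (l : 'I_n -> nat) :
  Phit (\prod_i j_hier m (l i) (a i)) = j_moment l.
Proof.
rewrite /j_hier bigA_distr_bigA linear_sum; apply: eq_bigr => k _ /=.
under eq_bigr => i _ do rewrite j_diffE.
rewrite bigA_distr_bigA linear_sum; apply: eq_bigr => e _ /=.
by rewrite prod_scale linearZ /= tens_word.
Qed.

Lemma Phit_prod_S_hier (N : nat) : Phit (\prod_i S_hier m N (a i)) =
  (sqrtC N%:R)^-1 ^+ n * \sum_(l : {ffun 'I_n -> 'I_N}) j_moment (fun i => l i).
Proof.
rewrite /S_hier prod_scale linearZ /= prodr_const card_ord; congr (_ * _).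
rewrite bigA_distr_bigA linear_sum; apply: eq_bigr => l _.
exact: Phit_prod_j_hier.
Qed.

Section Values.
Variables (A0 : set A) (phit : {scalar free_proj A}).
Hypotheses (A0_sub : star_subalgebra A0).
Hypothesis phit_bool : boolean_extension A0 phi phit.
Hypotheses (a_A0 : forall i, A0 (a i)) (a_centered : forall i, phi (a i) = 0).
Hypothesis Phit_prod : product_state phit Phit.

Lemma j_moment_single (l : 'I_n -> nat) i :
  (forall j, j != i -> l j != l i) -> j_moment l = 0.
Proof.
move=> li; apply: big1 => k _; apply: big1 => e _.
rewrite (@Phit_word_single _ _ _ _ _ phit_bool _ _ a_A0 a_centered _ Phit_prod
  _ _ _ i) ?mulr0 //.
by move=> j ji; rewrite xpair_eqE negb_and li.
Qed.

(** The number of terms depends on [m] and [n] only, and each coefficient has norm at most [1];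
    hence a bound uniform in [l]. *)
Lemma j_moment_bounded : exists K : C, forall l, `|j_moment l| <= K.
Proof.
have [K KP] := Phit_word_bounded phit_bool a Phit_prod.
exists (\sum_(k : {ffun 'I_n -> 'I_m}) \sum_(e : {ffun 'I_n -> bool}) K) => l.
apply: le_trans (ler_norm_sum _ _ _) _; apply: ler_sum => k _.
apply: le_trans (ler_norm_sum _ _ _) _; apply: ler_sum => e _.
rewrite normrM normr_prod.
apply: le_trans (KP l (fun i => k i) (fun i => (k i - e i)%N)).
rewrite ler_piMl //; apply: prodr_ile1 => i _; rewrite normr_ge0 /=.
rewrite normrM normrX normrN1 expr1n mul1r.
by case: leqP; rewrite ?normr0 ?normr1.
Qed.

(** For fixed [k] the condition on [e] is a conjunction over positions, so the sum over [e] factors.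
    The factor at [j] telescopes to [[M j <= k j] - [M j <= k j - 1] = [k j = M j]], which is the
    recursion in [levels]. *)
Lemma j_moment_pair (pi : 'I_n -> 'I_n) (l : 'I_n -> nat) :
    involutive pi -> (forall i, pi i != i) ->
    (forall i j, (l i == l j) = (j == i) || (j == pi i)) ->
  j_moment l = (\prod_(i < n | (i < pi i)%N) phi (a i * a (pi i))) *
    #|[pred k : {ffun 'I_n -> 'I_m} | `[< levels pi (fun i => k i) >]]|%:R.
Proof.
move=> piK pi_neq lE.
rewrite -sum1_card natr_sum [X in _ * X]big_mkcond mulr_sumr.
apply: eq_bigr => k _ /=; pose M j := \max_(i | covers pi i j) (k i).+1.
pose same := [forall i, k i == k (pi i)].
(* A threshold above the levels of all arcs covering [j] is one that is at least [M j], a condition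
   on [e j] alone once [k] is fixed. *)
have compatE (e : {ffun 'I_n -> bool}) :
    `[< (forall i, k i = k (pi i) :> nat) /\
        (forall i j, covers pi i j -> (k i < k j - e j)%N) >] =
    same && [forall j, (M j <= k j - e j)%N].
  apply/asboolP/andP => [[kpi kM]|[/forallP kpi /forallP kM]].
    split; apply/forallP => j; first by rewrite -val_eqE /= kpi.
    by apply/bigmax_leqP => i; apply: kM.
  split=> [i|i j ij]; first by have /eqP-> := kpi i.
  exact: (elimT (bigmax_leqP _ _ _) (kM j)).
have levelsE : `[< levels pi (fun i => k i) >] =
    same && [forall j, (k j == M j :> nat)].
  apply/asboolP/andP => [kP|[/forallP kpi /forallP kM] j].
    by split; apply/forallP => j; rewrite -?val_eqE /=; apply/eqP; have [] := kP j.
  by split; [have /eqP-> := kpi j|apply/eqP/kM].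
rewrite inE levelsE.
under eq_bigr => e _.
  rewrite (Phit_word_pair A0_sub phit_bool a_A0 a_centered Phit_prod
    piK pi_neq lE).
  rewrite compatE -mulnb natrM -(prodr_bool _ (fun j => (M j <= k j - e j)%N)).
  rewrite mulrCA [X in _ * X]mulrCA -big_split /=.
  over.
rewrite -!mulr_sumr; congr (_ * _).
transitivity (same%:R * \prod_j ((k j == M j :> nat)%:R : C)); last first.
  rewrite (prodr_bool _ (fun j => k j == M j :> nat)) -natrM mulnb.
  by case: (_ && _).
congr (_ * _).
rewrite -(bigA_distr_bigA (fun j (e : bool) =>
  (-1) ^+ e * (e <= k j)%N%:R * (M j <= k j - e)%N%:R)).
apply: eq_bigr => j _; rewrite big_bool /= expr1 expr0 !mul1r subn0.
(* At level [0] the hat is absent and [M j <= 0] already means [k j = M j]. *)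
have [k0|k0] := posnP (k j).
  by rewrite k0 /= !mulr0 mul0r add0r leqn0 eq_sym.
have -> : (M j <= k j - 1)%N = (M j < k j)%N by lia.
rewrite mulr1 mulN1r.
by case: (ltngtP (k j) (M j)) => _; rewrite ?oppr0 ?addr0 ?add0r ?addNr.
Qed.
End Values.
End Expansion.
(** * Counting words by kernel, and the limit *)

Section KernelCount.
Variables (T : finType) (P : {set {set T}}).
Hypothesis partP : finset.partition P [set: T]%SET.

Let trivP : finset.trivIset P. Proof. by case/and3P: partP. Qed.
Let covP x : x \in finset.cover P.
Proof. by rewrite (finset.cover_partition partP) inE. Qed.

Lemma preim_partition_eq (rT : eqType) (f : T -> rT) :
  preim_partition f [set: T]%SET = P <->
  forall x y, (f x == f y) = (y \in finset.pblock P x).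
Proof.
split=> [<- x y|fP].
  rewrite pblock_equivalence_partition ?inE // => u v w _ _ _.
  by split=> // /eqP->.
rewrite -[RHS](equivalence_partition_pblock partP).
by apply: eq_imset => x; apply/setP => y; rewrite !inE fP.
Qed.

(** Functions with kernel [P] correspond to injective functions on the type [D] of blocks, by
    composition with the block map [b]. *)
Lemma card_preim_partition (T' : finType) :
  #|[set f : {ffun T -> T'} | preim_partition f [set: T]%SET == P]%SET| =
  #|T'| ^_ #|P|.
Proof.
pose D : finType := {B : {set T} | B \in P}.
have cardD : #|D| = #|P| by rewrite card_sig; apply: eq_card => B; rewrite inE.
pose b x : D := exist _ (finset.pblock P x) (finset.pblock_mem (covP x)).
have b_eq x y : (b x == b y) = (y \in finset.pblock P x).
  by rewrite -finset.eq_pblock // -val_eqE.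
have b_surj (B : D) : exists x, b x = B.
  have /and3P[_ _ P0] := partP; case: B => B BP.
  have [B0|[x xB]] := set_0Vmem B; first by rewrite -B0 BP in P0.
  by exists x; apply: val_inj; rewrite /= (finset.def_pblock _ BP xB).
rewrite -cardD -card_inj_ffuns.
pose h (g : {ffun D -> T'}) : {ffun T -> T'} := [ffun x => g (b x)].
rewrite -(@card_in_imset _ _ h); last first.
  move=> g g' _ _ /ffunP gg'; apply/ffunP => B; have [x <-] := b_surj B.
  by have := gg' x; rewrite !ffunE.
apply: eq_card => f; rewrite inE; apply/eqP/imsetP => [/preim_partition_eq fP|[g]].
  pose g : {ffun D -> T'} := [ffun B => f (sval (cid (b_surj B)))].
  have gb x : g (b x) = f x.
    rewrite ffunE; case: cid => y /= /eqP; rewrite b_eq => yx.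
    by apply/eqP; rewrite fP.
  exists g; last by apply/ffunP => x; rewrite ffunE gb.
  rewrite inE; apply/injectiveP => B B'.
  have [x <-] := b_surj B; have [y <-] := b_surj B'.
  by rewrite !gb => /eqP; rewrite fP -b_eq => /eqP.
rewrite inE => /injectiveP g_inj ->; apply/preim_partition_eq => x y.
by rewrite !ffunE (inj_eq g_inj) b_eq.
Qed.

End KernelCount.

(** Each block has the form [b i] for exactly one left end [i], and the increasing order of the
    product puts [a i] before [a (pi i)]. *)
Lemma prod_pair_blocks (C : numClosedFieldType) (A : starAlgType C) (phi : A -> C)
    (n : nat) (a : 'I_n -> A) (P : {set {set 'I_n}}) (pi : 'I_n -> 'I_n) :
  pair_partition P -> involutive pi -> (forall i, pi i != i) ->
  (forall i, finset.pblock P i = [set i; pi i]%SET) ->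
  \prod_(B in P) phi (\prod_(i in B) a i) =
  \prod_(i < n | (i < pi i)%N) phi (a i * a (pi i)).
Proof.
move=> pairP piK pi_neq pbE; have [partP _] := andP pairP.
have /and3P[_ trivP P0] := partP.
pose b i := [set i; pi i]%SET.
have bE i : b i = finset.pblock P i by rewrite pbE.
have -> : P = [set b i | i in [pred i : 'I_n | (i < pi i)%N]]%SET.
  apply/setP => B; apply/idP/imsetP => [BP|[i _ ->]]; last first.
    by rewrite bE finset.pblock_mem // (finset.cover_partition partP) inE.
  have [B0|[x xB]] := set_0Vmem B; first by rewrite -B0 BP in P0.
  have BE : B = b x by rewrite bE (finset.def_pblock trivP BP xB).
  have /orP[il|ir] := partner_ltn pi_neq x; first by exists x.
  by exists (pi x); rewrite ?inE ?piK // /b piK finset.setUC.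
rewrite big_imset /= => [|i j]; last first.
  rewrite !inE => il jl /setP/(_ i); rewrite !inE eqxx /=.
  move=> /esym/orP[/eqP//|/eqP ij].
  by move: il jl; rewrite ij piK; lia.
apply: eq_bigr => i il; congr (phi _).
rewrite (prod_ord_split _ (j := i)) ?inE ?eqxx //=.
rewrite big_pred0 => [|j]; last first.
  by rewrite !inE -!val_eqE /=; move: (il); rewrite inE; lia.
rewrite mul1r (big_pred1 (pi i)) // => j.
by rewrite !inE -!val_eqE /=; move: (il); rewrite inE; lia.
Qed.

(** With no empty or singleton block every block has at least two elements, and one of them has at
    least three. *)
Lemma partition_ltn_card (T : finType) (P : {set {set T}}) :
  finset.partition P [set: T]%SET -> (forall B, B \in P -> #|B| != 1%N) ->
  ~~ [forall B in P, #|B| == 2%N] -> (#|P| * 2 < #|T|)%N.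
Proof.
move=> partP P1; have /and3P[_ _ P0] := partP.
have P2 (B : {set T}) : B \in P -> (2 <= #|B|)%N.
  move=> BP; have := P1 B BP; case E : #|B| => [|[|]] //.
  by move/cards0_eq: E => B0; rewrite -B0 BP in P0.
rewrite negb_forall_in => /exists_inP[B BP B2].
rewrite -cardsT (card_partition partP) -sum_nat_const.
rewrite (bigD1 B) //= [ltnRHS](bigD1 B) //=.
rewrite -addSn leq_add //; first by have := P2 B BP; lia.
by apply: leq_sum => B' /andP[/P2].
Qed.

(** * Convergence in [R[i]] and the contribution of one kernel *)

Section Limits.
Variable R : realType.
Local Notation C := R[i].

(** [0 <= x] forces [x] to be real, so the archimedean property of [R] applies. *)
Lemma nat_gt_complex (x : C) : 0 <= x -> exists N : nat, x < N%:R.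
Proof.
case: x => x y; rewrite lecE /= => /andP[/eqP-> x0]; exists (Num.bound x).
by rewrite -(rmorph_nat (real_complex R)) ltcR; apply: archi_boundP.
Qed.

Lemma cvg_of_sqrt_bound (u : nat -> C) (l K : C) :
  (forall N, (0 < N)%N -> `|l - u N| <= K * (sqrtC N%:R)^-1) ->
  (u : nat -> R[i]^o) @ \oo --> (l : R[i]^o).
Proof.
move=> uK; apply/cvgrPdist_lt => e e0.
have K0 : 0 <= K.
  by have := uK 1%N isT; rewrite sqrtC1 invr1 mulr1; apply: le_trans.
(* Once [N >= N0 > (K / e)^2], the bound [K / sqrt N] is below [e]. *)
have [N0 N0P] := nat_gt_complex (exprn_ge0 2 (divr_ge0 K0 (ltW e0))).
near=> N.
have N_gt0 : (0 < N)%N by near: N; exact: nbhs_infty_gt.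
have N0N : (N0 <= N)%N by near: N; exact: nbhs_infty_ge.
have sN : 0 < sqrtC (N%:R : C) by rewrite sqrtC_gt0 ltr0n.
apply: le_lt_trans (uK N N_gt0) _.
rewrite ltr_pdivrMr // -ltr_pdivrMl // mulrC.
rewrite -(@ltr_pXn2r _ 2) ?nnegrE ?(ltW sN) ?divr_ge0 ?(ltW e0) //.
by rewrite sqrtCK; apply: lt_le_trans N0P _; rewrite ler_nat.
Unshelve. all: by end_near. Qed.

(** Raising [p] by one multiplies the ratio by [(N - p) / N], which is within [p / N <= p / sqrt N]
    of [1]. *)
Lemma cvg_ffact_expn p :
  (fun N : nat => (N ^_ p)%:R / N%:R ^+ p : R[i]^o) @ \oo --> (1 : R[i]^o).
Proof.
elim: p => [|p IHp].
  rewrite (_ : (fun _ => _) = fun=> 1); first exact: cvg_cst.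
  by apply/funext => N; rewrite ffactn0 expr0 divr1.
rewrite (_ : (fun _ => _) = (fun N : nat => ((N ^_ p)%:R / N%:R ^+ p)
  * ((N - p)%:R / N%:R : R[i]^o))); last first.
  by apply/funext => N; rewrite ffactnSr natrM exprSr invfM mulrACA.
rewrite -[X in _ --> X]mulr1; apply: cvgM IHp _.
apply: (@cvg_of_sqrt_bound _ _ p%:R) => N N_gt0.
have N0 : 0 < N%:R :> C by rewrite ltr0n.
rewrite -[X in X - _](divff (lt0r_neq0 N0)) -mulrBl -natrB ?leq_subr //.
rewrite ger0_norm ?divr_ge0 ?ler0n //.
rewrite ler_pM ?ler0n ?invr_ge0 ?sqrtC_ge0 ?ler0n //.
  by rewrite ler_nat; lia.
rewrite lef_pV2 ?posrE ?sqrtC_gt0 // -{2}(sqrtCK N%:R) ler_eXnr //.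
by rewrite -[leLHS]sqrtC1 ler_sqrtC ?nnegrE ?ler0n ?ler01 // ler1n.
Qed.


Lemma ffact_leq_expn (N p : nat) : (N ^_ p <= N ^ p)%N.
Proof.
elim: p => // p IHp; rewrite ffactnSr expnSr.
exact: leq_mul IHp (leq_subr _ _).
Qed.

Section KernelTerms.
Variables (A : starAlgType C) (A0 : set A) (phi : {scalar A}).
Variables (phit : {scalar free_proj A}) (Phit : {scalar tensor_alg A}).
Hypotheses (A0_sub : star_subalgebra A0).
Hypothesis phit_bool : boolean_extension A0 phi phit.
Hypothesis Phit_prod : product_state phit Phit.
Variables (m n : nat) (a : 'I_n -> A).
Hypotheses (a_A0 : forall i, A0 (a i)) (a_centered : forall i, phi (a i) = 0).
Implicit Type P : {set {set 'I_n}}.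

Definition kernel_term P (N : nat) : C :=
  (sqrtC N%:R)^-1 ^+ n *
  \sum_(l : {ffun 'I_n -> 'I_N} | preim_partition l [set: 'I_n]%SET == P)
    j_moment Phit m a (fun i => l i).

Lemma cvg_kernel_term P : finset.partition P [set: 'I_n]%SET ->
  (kernel_term P : nat -> R[i]^o) @ \oo -->
  ((if P \in NCpair n m then \prod_(B in P) phi (\prod_(i in B) a i) else 0)
    : R[i]^o).
Proof.
move=> partP.
have kerE N (l : {ffun 'I_n -> 'I_N}) : preim_partition l [set: 'I_n]%SET == P ->
    forall i j, (l i == l j :> nat) = (j \in finset.pblock P i).
  by move=> /eqP/(preim_partition_eq partP) lP i j; rewrite -lP -val_eqE.
case: (boolP (pair_partition P)) => [pairP|nP].
  have [pi [piK pi_neq pbE]] := pair_partition_partner pairP.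
  pose c : C := \prod_(i < n | (i < pi i)%N) phi (a i * a (pi i)) *
    (P \in NCpair n m)%:R.
  rewrite (_ : (if _ then _ else _) = c); last first.
    rewrite /c (prod_pair_blocks _ _ pairP piK pi_neq pbE).
    by case: ifP; rewrite ?mulr1 ?mulr0.
  (* All words with kernel [P] have the same moment [c], there are [N ^_ #|P|] of them, and
     [n = 2 #|P|] turns the normalisation into [N ^- #|P|]. *)
  have termE : kernel_term P =
      (fun N : nat => (N ^_ #|P|)%:R / N%:R ^+ #|P| * c).
    apply/funext => N; rewrite /kernel_term.
    rewrite (eq_bigr (fun=> c)) => [|l lP]; last first.
      rewrite (j_moment_pair m A0_sub phit_bool a_A0 a_centered Phit_prod
        piK pi_neq).
        by rewrite (card_levels pairP piK pi_neq pbE).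
      by move=> i j; rewrite (kerE N l lP) pbE !inE.
    rewrite sumr_const -[X in c *+ X]cardsE (card_preim_partition partP) card_ord.
    rewrite -[c *+ _]mulr_natl mulrA [X in X * _]mulrC; congr (_ * _ * _).
    rewrite exprVn [X in _ ^+ X](card_pair_partition pairP).
    by rewrite mulnC exprM sqrtCK.
  rewrite termE -[X in _ --> X]mul1r; apply: cvgM; first exact: cvg_ffact_expn.
  exact: cvg_cst.
rewrite inE (negbTE nP) /=.
(* The position in a singleton block has an index of its own, so its centered letter makes every
   moment vanish. *)
case: (boolP [exists B in P, #|B| == 1%N])
  => [/exists_inP[B BP /cards1P[i BE]]|n1].
  rewrite (_ : kernel_term P = fun=> 0); first exact: cvg_cst.
  apply/funext => N; rewrite /kernel_term big1 ?mulr0 // => l lP.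
  apply: (j_moment_single m phit_bool a_A0 a_centered Phit_prod (i := i)) => j ji.
  have /and3P[_ trivP _] := partP.
  by rewrite eq_sym (kerE N l lP) (finset.def_pblock trivP BP) BE inE.
have ltPn : (#|P| * 2 < n)%N.
  rewrite -[ltnRHS]card_ord; apply: partition_ltn_card => //.
    by move=> B BP; apply: contra n1 => B1; apply/exists_inP; exists B.
  by apply: contra nP => P2; rewrite /pair_partition partP.
have [K KP] := j_moment_bounded m a phit_bool Phit_prod.
have K0 : 0 <= K by apply: le_trans (KP (fun=> 0%N)).
apply: (@cvg_of_sqrt_bound _ _ K) => N N_gt0; rewrite sub0r normrN.
pose s : C := sqrtC N%:R.
have s_ge1 : 1 <= s.
  by rewrite -[leLHS]sqrtC1 ler_sqrtC ?nnegrE ?ler0n ?ler01 // ler1n.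
have s_gt0 : 0 < s by apply: lt_le_trans s_ge1.
rewrite /kernel_term -/s normrM normrX normfV (ger0_norm (ltW s_gt0)).
(* At most [N ^ #|P| = s ^ (2 #|P|)] words have kernel [P], and [2 #|P| + 1 <= n] leaves a factor
   [1 / s]. *)
apply: (@le_trans _ _ (s^-1 ^+ n * (s ^+ (#|P| * 2) * K))).
  rewrite ler_wpM2l ?exprn_ge0 ?invr_ge0 ?(ltW s_gt0) //.
  apply: le_trans (ler_norm_sum _ _ _) _.
  apply: (@le_trans _ _ (\sum_(l : {ffun 'I_n -> 'I_N} |
      preim_partition l [set: 'I_n]%SET == P) K)); first exact: ler_sum.
  rewrite sumr_const -[X in K *+ X]cardsE (card_preim_partition partP) card_ord.
  rewrite -mulr_natl ler_wpM2r // mulnC exprM sqrtCK -natrX ler_nat.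
  exact: ffact_leq_expn.
rewrite mulrA mulrC ler_wpM2l // exprVn ler_pdivrMl ?exprn_gt0 //.
by rewrite ler_pdivlMr // -exprSr ler_weXn2l.
Qed.

End KernelTerms.
End Limits.

Theorem theorem3p5 (R : realType) (A : starAlgType R[i]) (A0 : set A)
    (A0_sub : star_subalgebra A0) (A0_dec : unit_complement A0)
    (phi : {scalar A}) (phi_state : is_state phi)
    (phit : {scalar free_proj A}) (phit_bool : boolean_extension A0 phi phit)
    (Phit : {scalar tensor_alg A}) (Phit_prod : product_state phit Phit)
    (m : nat) (m_gt0 : (0 < m)%N) (n : nat) (a : 'I_n -> A)
    (a_A0 : forall i, A0 (a i)) (a_centered : forall i, phi (a i) = 0) :
  (~~ odd n ->
     (fun N : nat => Phit (\prod_(i < n) S_hier m N (a i)) : R[i]^o) @ \oo -->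
     (\sum_(P in NCpair n m)
        \prod_(B in P) phi (\prod_(i in B) a i) : R[i]^o)) /\
  (odd n ->
     (fun N : nat => Phit (\prod_(i < n) S_hier m N (a i)) : R[i]^o) @ \oo -->
     (0 : R[i]^o)).
Proof.
have Phit_lim :
    (fun N : nat => Phit (\prod_(i < n) S_hier m N (a i)) : R[i]^o) @ \oo -->
    (\sum_(P in NCpair n m) \prod_(B in P) phi (\prod_(i in B) a i) : R[i]^o).
  rewrite (_ : (fun _ => _) = fun N : nat =>
      \sum_(P | finset.partition P [set: 'I_n]%SET)
        kernel_term Phit m a P N : R[i]^o); last first.
    apply/funext => N; rewrite Phit_prod_S_hier.
    rewrite (partition_big
      (fun l : {ffun 'I_n -> 'I_N} => preim_partition l [set: 'I_n]%SET)
      (fun P => finset.partition P [set: 'I_n]%SET)) /=; last first.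
      by move=> l _; apply: preim_partitionP.
    by rewrite mulr_sumr.
  rewrite (_ : \sum_(P in NCpair n m) _ =
      \sum_(P | finset.partition P [set: 'I_n]%SET)
        if P \in NCpair n m then \prod_(B in P) phi (\prod_(i in B) a i)
        else 0); last first.
    rewrite -big_mkcondr; apply: eq_bigl => P.
    apply/idP/andP => [PNC|[]//]; split=> //.
    by move: PNC; rewrite inE => /and3P[/andP[]].
  apply: cvg_big => [|P partP]; first exact: add_continuous.
  exact: (cvg_kernel_term A0_sub phit_bool Phit_prod (m := m)
    a_A0 a_centered partP).
split=> [_|n_odd]; first exact: Phit_lim.
(* A pair partition makes [n] even, so for odd [n] the limit is an empty sum. *)
rewrite big_pred0 in Phit_lim; first exact: Phit_lim.
move=> P; rewrite inE.
apply/negP => /andP[/card_pair_partition nE _].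
by move: n_odd; rewrite nE oddM andbF.
Qed.
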